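(* Fix an integer $\sigma\ge 1$. For each $n$, let $$Y_{\sigma,n}=\min\{\tau\ge 1:\mathcal{P}_{\tau,\sigma,n}\neq\emptyset\}$$ be the smallest temporal period of a periodic solution with spatial period $\sigma$ of a uniformly random two-neighbor cellular automaton rule with $n$ states (with $\min\emptyset=\infty$). Then, as $n\to\infty$, $Y_{\sigma,n}$ converges weakly to a nontrivial distribution, i.e. to a probability distribution on $\mathbb{N}=\{1,2,\dots\}$ that is not concentrated at a single point.
   Context: Let $\mathbb{Z}_n=\{0,1,\dots,n-1\}$. A rule is a function $f:\mathbb{Z}_n^2\to\mathbb{Z}_n$. Given an initial configuration $\xi_0:\mathbb{Z}\to\mathbb{Z}_n$, the rule determines $\xi_t$, $t\ge 0$, by $\xi_{t+1}(x)=f(\xi_t(x-1),\xi_t(x))$ for all $x\in\mathbb{Z}$. A periodic solution (PS) of $f$ with temporal period $\tau\ge1$ and spatial period $\sigma\ge1$ is a space-time configuration $(x,t)\mapsto\xi_t(x)$ generated by $f$ such that $\sigma$ is the smallest positive integer with $\xi_0(x+\sigma)=\xi_0(x)$ for all $x\in\mathbb{Z}$, and $\tau$ is the smallest positive integer with $\xi_\tau(x)=\xi_0(x)$ for all $x\in\mathbb{Z}$. Periodic solutions that differ by a spatial and/or temporal translation are identified. The rule $f$ is chosen uniformly at random from the $n^{n^2}$ rules, and $\mathcal{P}_{\tau,\sigma,n}$ is the random set of PS of $f$ with temporal period $\tau$ and spatial period $\sigma$. *)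

(* Defs.v *)
From HB Require Import structures.
From mathcomp Require Import all_boot all_order all_algebra.
From mathcomp Require Import finmap.
From mathcomp Require Import all_classical all_reals all_analysis.
From mathcomp Require Import measurable_realfun.
Set Implicit Arguments.
Unset Strict Implicit.
Unset Printing Implicit Defensive.
Import Order.TTheory GRing.Theory Num.Theory.
Import numFieldNormedType.Exports.
Local Open Scope classical_set_scope.
Local Open Scope ring_scope.

Definition rule (n : nat) : Type := {ffun 'I_n * 'I_n -> 'I_n}.

HB.instance Definition _ n := Finite.on (rule n).
(* The first projection is a rule for every n, including n = 0. *)
HB.instance Definition _ n :=
  isPointed.Build (rule n) [ffun p : 'I_n * 'I_n => p.1].
HB.instance Definition _ n := @isMeasurable.Build default_measure_display
  (rule n) discrete_measurable discrete_measurable0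
  discrete_measurableC discrete_measurableU.

Definition spacetime (n : nat) : Type := nat -> int -> 'I_n.

Definition generated_by n (f : rule n) (xi : spacetime n) : Prop :=
  forall t x, xi t.+1 x = f (xi t (x - 1), xi t x).

Definition smallest_positive (P : nat -> Prop) (m : nat) : Prop :=
  [/\ (0 < m)%N, P m & forall k, (0 < k)%N -> P k -> (m <= k)%N].

Definition is_PS n (f : rule n) (tau sigma : nat) (xi : spacetime n) : Prop :=
  [/\ generated_by f xi,
      smallest_positive
        (fun s => forall x : int, xi 0%N (x + s%:Z) = xi 0%N x) sigma &
      smallest_positive (fun t => forall x : int, xi t x = xi 0%N x) tau].

(* Periodic solutions are counted modulo spatial and temporal translation. A
   periodic solution recurs in time, so nonnegative temporal shifts already
   yield its full class modulo translation. *)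
Definition translation_class n (xi : spacetime n) : set (spacetime n) :=
  [set eta | exists (s : nat) (a : int),
     forall t x, eta t x = xi (t + s)%N (x + a)].

Definition PS n (f : rule n) (tau sigma : nat) : set (set (spacetime n)) :=
  [set translation_class xi | xi in is_PS f tau sigma].

Section probability.
Context {R : realType}.

Definition uniform_rule (n : nat) : set (rule n) -> \bar R :=
  mscale (#|{: rule n}|%:R^-1)%:nng (@counting (rule n) R).

Arguments uniform_rule : clear implicits.
HB.instance Definition _ n := Measure.on (uniform_rule n).

Let uniform_rule_setT n : uniform_rule n setT = 1%E.
Proof.
rewrite /uniform_rule /mscale/= /counting asboolT; last exact: finite_finset.
have -> : fset_set [set: rule n] = [fset x in enum {: rule n}]%fset.
  apply/fsetP => x; rewrite in_fset_set; last exact: finite_finset.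
  by rewrite in_setT !inE mem_enum.
rewrite card_fseq undup_id ?enum_uniq// -cardE -EFinM mulVf//.
by rewrite pnatr_eq0 -lt0n; apply/card_gt0P; exists point.
Qed.

HB.instance Definition _ n :=
  Measure_isProbability.Build _ _ _ (uniform_rule n) (uniform_rule_setT n).

(* The infimum of the empty set is +oo, and a nonempty set of positive integers
   attains its infimum, so this is the minimum. *)
Definition Y (sigma n : nat) (f : rule n) : \bar R :=
  ereal_inf [set tau%:R%:E | tau in
    [set tau : nat | (1 <= tau)%N /\ PS f tau sigma !=set0]].

Arguments Y : clear implicits.
Let measurable_Y sigma n : measurable_fun setT (Y sigma n).
Proof. by []. Qed.

HB.instance Definition _ sigma n :=
  isMeasurableFun.Build _ _ _ _ (Y sigma n) (@measurable_Y sigma n).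

(* Test functions live on \bar R rather than on the reals because the laws may
   charge +oo. *)
Definition weakly_converges (P : nat -> probability (\bar R) R)
    (Q : probability (\bar R) R) : Prop :=
  forall g : \bar R -> R, continuous g ->
    (exists M : R, forall x, `|g x| <= M) ->
    (\int[P n]_x (g x)%:E)%E @[n --> \oo] --> (\int[Q]_x (g x)%:E)%E.

Definition positive_naturals : set (\bar R) :=
  [set k%:R%:E | k in [set k : nat | (1 <= k)%N]].

End probability.

Arguments Y {R} sigma n f.
Arguments uniform_rule {R} n A.

(* Main.v *)
(* A periodic solution of spatial period sigma and temporal period at most T is
   a tile on the torus Z_(T!) x Z_sigma obeying the rule. A tile with s states
   and p distinct inputs (pairs of neighbouring states) is obeyed with
   probability n^-p, there are O(n^s) tiles with s states, and p >= s since
   every state is the output of some input; so only the simple tiles, p = s,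
   matter in the limit, and their expected number of translation orbits
   converges.

   The number X of orbits is asymptotically Poisson by size biasing. Given that
   a tile g is obeyed, the rule is distributed as a uniform rule overwritten by
   g on the inputs of g, and X increases by one under this overwriting unless
   another tile shares an input with g. The latter is negligible: a simple tile
   determines the past of each of its states, so the union of two tiles sharing
   a state has p > s unless they are translates of each other. Hence
   (k+1) P(X = k+1) = lambda_T P(X = k) + O(1/n) for all k, which together with
   Markov's inequality gives P(Y > T) = P(X = 0) -> exp(- lambda_T). Finally
   lambda_T >= sum_(tau <= T) 1 / (tau sigma) is unbounded, so no mass
   escapes. *)
Require Import Defs.
From HB Require Import structures.
From mathcomp Require Import all_boot all_order all_algebra.
From mathcomp Require Import finmap.
From mathcomp Require Import all_classical all_reals all_analysis.
From mathcomp Require Import measurable_realfun.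
From mathcomp Require Import ring lra zify.
Set Implicit Arguments.
Unset Strict Implicit.
Unset Printing Implicit Defensive.
Import Order.TTheory GRing.Theory Num.Theory.
Import numFieldNormedType.Exports.
Local Open Scope ring_scope.

(** * Patterns of inputs and states *)

(* A pattern assigns states to cells; cell [nx c] is computed from the parent
   cells [l c] and [m c]. *)
Section Pattern.
Variables (I : finType) (l m nx : I -> I) (E : finType).
Hypothesis nx_inj : injective nx.
Implicit Types (g : {ffun I -> E}) (f : {ffun E * E -> E}).

Definition obeys g f := [forall c, f (g (l c), g (m c)) == g (nx c)].

Definition inputs g : {set E * E} := [set (g (l c), g (m c)) | c : I].

Definition states g : {set E} := [set g c | c : I].

(** If no rule obeys [g], cells with the same input may prescribe different outputs, and [pick]
    selects one of them. *)
Definition overwrite g f : {ffun E * E -> E} :=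
  [ffun d => if [pick c | (g (l c), g (m c)) == d] is Some c
             then g (nx c) else f d].

Lemma obeysP g f :
  reflect (forall c, f (g (l c), g (m c)) = g (nx c)) (obeys g f).
Proof. by apply: (iffP forallP) => H c; apply/eqP. Qed.

Lemma overwriteE g f f' : obeys g f' ->
  overwrite g f = [ffun d => if d \in inputs g then f' d else f d].
Proof.
move=> /obeysP gf'; apply/ffunP => d; rewrite !ffunE.
case: pickP => [c /eqP <-|nod].
  by rewrite gf' imset_f.
by case: imsetP => // -[c _ dE]; have := nod c; rewrite dE eqxx.
Qed.

Lemma obeys_overwrite g f f' : obeys g f' -> obeys g (overwrite g f).
Proof.
move=> gf'; rewrite (overwriteE f gf'); apply/obeysP => c.
by rewrite ffunE imset_f//; exact/obeysP.
Qed.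

Lemma overwrite_out g f d : d \notin inputs g -> overwrite g f d = f d.
Proof.
move=> dg; rewrite ffunE; case: pickP => // c /eqP dE.
by rewrite -dE imset_f in dg.
Qed.

Lemma card_overwrite g f' : obeys g f' ->
  #|[set f | overwrite g f == f']| = (#|E| ^ #|inputs g|)%N.
Proof.
move=> gf'.
pose F d := [pred e | (d \in inputs g) || (e == f' d)].
have -> : #|[set f | overwrite g f == f']| = #|family F|.
  apply: eq_card => f; rewrite finset.in_set (overwriteE f gf').
  apply/idP/familyP => [/eqP ff' d|ff'].
    rewrite inE /=; have := congr1 (fun u : {ffun _ -> _} => u d) ff'.
    rewrite ffunE.
    by case: (d \in _) => //= ->.
  apply/eqP/ffunP => d; rewrite ffunE; case: ifPn => // dg.
  by have := ff' d; rewrite inE /= (negbTE dg)/= => /eqP.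
rewrite card_family foldrE big_map big_enum /=.
rewrite (bigID [in inputs g])/= mulnC big1 ?mul1n; last first.
  move=> d dg; rewrite -(card1 (f' d)); apply: eq_card => e.
  by rewrite !inE (negbTE dg).
rewrite (eq_bigr (fun=> #|E|)) ?prod_nat_const// => d dg.
by apply: eq_card => e; rewrite !inE [d \in _]dg.
Qed.

(** By [card_overwrite] all fibres over obeying rules have the same size, so a uniform rule
    conditioned on obeying [g] is a uniform rule overwritten by [g]. *)
Lemma sum_overwrite (R : realFieldType) g f0 (h : {ffun E * E -> E} -> R) :
  obeys g f0 -> (0 < #|E|)%N ->
  \sum_(f | obeys g f) h f =
  #|E|%:R ^- #|inputs g| * \sum_f h (overwrite g f).
Proof.
move=> gf0 E0.
rewrite [in RHS](partition_big (overwrite g) (obeys g)) /=; last first.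
  by move=> f _; exact: obeys_overwrite gf0.
rewrite mulr_sumr; apply: eq_bigr => f' gf'.
rewrite (eq_bigr (fun=> h f')); last by move=> f /eqP ->.
rewrite sumr_const [X in h f' *+ X](_ : _ = (#|E| ^ #|inputs g|)%N); last first.
  by rewrite -(card_overwrite gf') cardsE.
rewrite -[h f' *+ _]mulr_natl mulrA.
by rewrite natrX mulVf ?mul1r// expf_neq0// pnatr_eq0 -lt0n.
Qed.

(** An injection [nx] of a finite type is onto, so every state is an output. *)
Lemma states_obeys g f : obeys g f -> states g = [set f d | d in inputs g].
Proof.
move=> /obeysP gf; apply/setP => e; apply/imsetP/imsetP => [[c _ ->]|].
  exists (g (l (invF nx_inj c)), g (m (invF nx_inj c))); first exact: imset_f.
  by rewrite gf f_invF.
by move=> [d /imsetP [c _ ->] ->]; exists (nx c) => //; rewrite gf.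
Qed.

Lemma leq_states_inputs g f : obeys g f -> (#|states g| <= #|inputs g|)%N.
Proof. by move=> gf; rewrite (states_obeys gf) leq_imset_card. Qed.

(* A pattern has as many states as inputs exactly when each of its states has a
   unique pair of parents. *)
Definition simple (g : {ffun I -> E}) := [forall c, forall c',
  (g (nx c) == g (nx c')) == ((g (l c), g (m c)) == (g (l c'), g (m c')))].

Lemma simpleP g : reflect (forall c c', (g (nx c) == g (nx c')) =
  ((g (l c), g (m c)) == (g (l c'), g (m c')))) (simple g).
Proof.
apply: (iffP forallP) => [H c c'|H c].
  by have /forallP/(_ c')/eqP := H c.
by apply/forallP => c'; rewrite H.
Qed.

(** Equal cardinalities mean that [f] is injective on the inputs, which is uniqueness of parents. *)
Lemma simple_obeys g f : obeys g f ->
  simple g = (#|inputs g| == #|states g|).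
Proof.
move=> gf; rewrite (states_obeys gf) eq_sym.
move/obeysP : gf => gf.
apply/simpleP/imset_injP => [H|H c c'].
  move=> _ _ /imsetP[c _ ->] /imsetP[c' _ ->] /eqP.
  by rewrite !gf H => /eqP.
apply/eqP/eqP => [|[le me]]; rewrite -?gf ?le ?me//.
by move/H; apply; exact: imset_f.
Qed.

Lemma simple_obeysW g (e0 : E) : simple g -> exists f, obeys g f.
Proof.
move=> /simpleP H.
exists (overwrite g [ffun=> e0]); apply/obeysP => c.
rewrite ffunE; case: pickP => [c' Hc'|/(_ c)]; last by rewrite eqxx.
by apply/eqP; rewrite H.
Qed.

End Pattern.

(** * Counting patterns by their kernel *)

Section Kernel.
Variable I : finType.

(* The equivalence relation [g c = g c'], encoded by a canonical choice of
   representatives; this is again a pattern, with states in [I]. *)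
Definition kernel (E : finType) (g : {ffun I -> E}) : {ffun I -> I} :=
  [ffun c => odflt c [pick c' | g c' == g c]].

Lemma kernelK (E : finType) (g : {ffun I -> E}) c : g (kernel g c) = g c.
Proof. by rewrite ffunE; case: pickP => [c' /eqP|]. Qed.

Lemma kernelE (E : finType) (g : {ffun I -> E}) c c' :
  (kernel g c == kernel g c') = (g c == g c').
Proof.
apply/eqP/eqP => [kk|kk]; first by rewrite -(kernelK g c) kk kernelK.
rewrite !ffunE (eq_pick (Q := fun c0 => g c0 == g c')); last first.
  by move=> x; rewrite kk.
by case: pickP => // /(_ c'); rewrite eqxx.
Qed.

Lemma eq_kernelP (E E' : finType) (g : {ffun I -> E}) (h : {ffun I -> E'}) :
  (forall c c', (g c == g c') = (h c == h c')) <-> kernel g = kernel h.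
Proof.
split=> [gh|gh c c']; last by rewrite -kernelE gh kernelE.
apply/ffunP => c; rewrite !ffunE.
by rewrite (eq_pick (Q := fun c' => h c' == h c)).
Qed.

Lemma kernel_id (E : finType) (g : {ffun I -> E}) :
  kernel (kernel g) = kernel g.
Proof. by apply/eq_kernelP => c c'; rewrite kernelE. Qed.

Lemma card_states_kernel (E : finType) (g : {ffun I -> E}) :
  #|states (kernel g)| = #|states g|.
Proof.
have -> : states g = g @: states (kernel g).
  rewrite /states -imset_comp; apply: eq_imset => c /=.
  by rewrite kernelK.
rewrite card_in_imset// => _ _ /imsetP[c _ ->] /imsetP[c' _ ->].
by rewrite !kernelK => /eqP; rewrite -kernelE => /eqP.
Qed.

(** A map with kernel [k] amounts to an injection into [E] of the set [states k] of representatives;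
    [Phi] is this correspondence. *)
Lemma card_kernel (E : finType) (k : {ffun I -> I}) : kernel k = k ->
  #|[set g : {ffun I -> E} | kernel g == k]| = (#|E| ^_ #|states k|)%N.
Proof.
move=> kk; pose K := {x | x \in states k}.
have kc c : k c \in states k by exact: imset_f.
pose kin c : K := exist _ (k c) (kc c).
pose Phi (h : {ffun K -> E}) : {ffun I -> E} := [ffun c => h (kin c)].
have KP (x : K) : exists c, x = kin c.
  by case: x => x xk; have /imsetP[c _ xE] := xk; exists c; apply: val_inj.
have -> : #|states k| = #|{: K}| by rewrite card_sig.
rewrite -card_inj_ffuns -(card_imset _ (f := Phi)); last first.
  move=> h h' hh'; apply/ffunP => x; have [c ->] := KP x.
  by have := congr1 (fun u : {ffun I -> E} => u c) hh'; rewrite !ffunE.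
apply: eq_card => g; rewrite finset.in_set; apply/eqP/imsetP => [gk|[h]].
  exists [ffun x : K => g (val x)]; last first.
    by apply/ffunP => c; rewrite !ffunE /= -gk kernelK.
  rewrite finset.in_set; apply/injectiveP => x y; rewrite !ffunE.
  have [c ->] := KP x; have [c' ->] := KP y => /=.
  have gE d : g (k d) = g d by rewrite -gk kernelK.
  rewrite !gE => /eqP; rewrite -kernelE gk => /eqP cc'.
  exact: val_inj.
rewrite finset.in_set => /injectiveP hI ->; rewrite -[RHS]kk.
apply/eq_kernelP => c c'; rewrite !ffunE.
by rewrite (inj_eq hI) -(inj_eq val_inj).
Qed.

Variable R : realFieldType.

(** Grouping by kernel leaves a falling factorial over the matching power, a ratio that tends to 1
    as [E] grows. *)
Lemma sum_kernel (E : finType) (w : {ffun I -> I} -> R) :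
  \sum_(g : {ffun I -> E}) w (kernel g) * #|E|%:R ^- #|states g| =
  \sum_(k | kernel k == k)
     w k * ((#|E| ^_ #|states k|)%:R / #|E|%:R ^+ #|states k|).
Proof.
rewrite (partition_big (@kernel E) (fun k => kernel k == k)) /=; last first.
  by move=> g _; rewrite kernel_id.
apply: eq_bigr => k /eqP kk.
rewrite (eq_bigr (fun=> w k * #|E|%:R ^- #|states k|)); last first.
  by move=> g /eqP <-; rewrite card_states_kernel.
rewrite sumr_const [X in _ *+ X](_ : _ = (#|E| ^_ #|states k|)%N); last first.
  by rewrite -(card_kernel E kk) cardsE.
by rewrite -mulrnAr -[X in _ * X = _]mulr_natl.
Qed.

(** Each kernel contributes a ratio of at most 1, which makes the bound independent of [E]. *)
Lemma sum_states_le (E : finType) : (0 < #|E|)%N ->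
  \sum_(g : {ffun I -> E}) (#|E|%:R ^- #|states g| : R) <=
  #|{: {ffun I -> I}}|%:R.
Proof.
move=> E0.
rewrite (eq_bigr (fun g => 1 * #|E|%:R ^- #|states g|)); last first.
  by move=> *; rewrite mul1r.
rewrite (sum_kernel E (fun=> 1)) -[#|{: {ffun I -> I}}|]sum1_card natr_sum.
rewrite [leRHS](bigID (fun k : {ffun I -> I} => kernel k == k)) /=.
rewrite -[leLHS]addr0.
apply: lerD; last by apply: sumr_ge0.
apply: ler_sum => k _; rewrite mul1r.
rewrite ler_pdivrMr ?exprn_gt0 ?ltr0n// mul1r -natrX ler_nat.
rewrite ffact_prod -[X in (_ ^ X)%N]card_ord -prod_nat_const.
by apply: leq_prod => i _; exact: leq_subr.
Qed.

End Kernel.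

(** * Tiles on the discrete torus *)

(* The first coordinate is time, the second is space. *)
Section Torus.
Variables N S : nat.

Definition torus := ('I_N.+1 * 'I_S.+1)%type.
HB.instance Definition _ := Finite.on torus.
HB.instance Definition _ := GRing.Zmodule.on torus.

Definition tstep : torus := (inZp 1, 0).
Definition xstep : torus := (0, inZp 1).

Lemma tstepMn k : tstep *+ k = (inZp k, 0).
Proof.
elim: k => [|k IHk]; first by congr pair; apply: val_inj.
by rewrite mulrS IHk; congr pair; apply: val_inj; rewrite //= modnDm add1n.
Qed.

Lemma xstepMn k : xstep *+ k = (0, inZp k).
Proof.
elim: k => [|k IHk]; first by congr pair; apply: val_inj.
by rewrite mulrS IHk; congr pair; apply: val_inj; rewrite //= modnDm add1n.
Qed.

Lemma torusE (h : torus) : h = tstep *+ h.1 + xstep *+ h.2.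
Proof.
rewrite tstepMn xstepMn; case: h => a b /=; congr pair => /=.
  by rewrite addr0 valZpK.
by rewrite add0r valZpK.
Qed.

(* [h] lies in the backward light cone of [0]. *)
Lemma torus_cone (h : torus) :
  exists i j : nat, h = xstep *+ i + tstep *+ (i + j).
Proof.
(* Here [i + j = h.1 + h.2 * N.+1], congruent to [h.1] modulo the time period [N.+1]. *)
exists h.2, (h.1 + h.2 * N)%N; rewrite [LHS]torusE addrC; congr (_ + _).
rewrite !tstepMn; congr pair; apply: val_inj => /=.
by rewrite addnC -addnA -mulnSr addnC modnMDl.
Qed.

Definition left (c : torus) := c - xstep.
Definition up (c : torus) := c + tstep.

Lemma up_inj : injective up.
Proof. exact: addIr. Qed.

Section Tile.
Variable E : finType.
Implicit Types (g : {ffun torus -> E}) (h : torus).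

Definition shift h g : {ffun torus -> E} := [ffun c => g (c + h)].

Definition orb g := [set shift h g | h : torus].

Definition stab g : {set torus} := [set h | shift h g == g].

Lemma shift0 g : shift 0 g = g.
Proof. by apply/ffunP => c; rewrite ffunE addr0. Qed.

Lemma shiftD h h' g : shift h (shift h' g) = shift (h + h') g.
Proof. by apply/ffunP => c; rewrite !ffunE addrA. Qed.

Lemma shift_inj h : injective (shift h).
Proof.
by move=> g g' /(congr1 (shift (- h))); rewrite !shiftD addNr !shift0.
Qed.

Lemma orb_refl g : g \in orb g.
Proof. by apply/imsetP; exists 0; rewrite ?shift0. Qed.

Lemma orb_shift h g : orb (shift h g) = orb g.
Proof.
apply/setP => g'; apply/imsetP/imsetP => -[k _ ->].
  by exists (k + h); rewrite ?shiftD.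
by exists (k - h); rewrite // shiftD addrNK.
Qed.

Lemma orb_eq g g' : (orb g == orb g') = (g \in orb g').
Proof.
apply/eqP/idP => [<-|/imsetP[h _ ->]]; first exact: orb_refl.
exact: orb_shift.
Qed.

Lemma stab_shift h g : stab (shift h g) = stab g.
Proof.
apply/setP => k; rewrite !inE shiftD addrC -shiftD.
by rewrite (inj_eq (@shift_inj h)).
Qed.

(** The translations that send [g] to [shift h g] form the coset of [stab g] through [h]. *)
Lemma card_orb_stab g : (#|orb g| * #|stab g| = #|{: torus}|)%N.
Proof.
rewrite -[RHS]sum1_card (partition_big_imset (shift^~ g)) /=.
rewrite -sum_nat_const; apply: eq_bigr => _ /imsetP[h _ ->].
rewrite sum1dep_card -(card_imset _ (@addIr _ h)).
apply: eq_card => k; rewrite [in RHS]finset.in_set.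
apply/imsetP/idP => [[k']|/eqP kh].
  by rewrite inE => /eqP k'g ->; rewrite addrC -shiftD k'g eqxx.
exists (k - h); rewrite ?subrK// inE.
by rewrite -(inj_eq (@shift_inj h)) shiftD addrC subrK kh.
Qed.

Lemma card_stab_gt0 g : (0 < #|stab g|)%N.
Proof. by apply/card_gt0P; exists 0; rewrite inE shift0. Qed.

Notation tobeys := (obeys left id up).
Notation tinputs := (inputs left id).

Lemma obeys_shift h g f : tobeys (shift h g) f = tobeys g f.
Proof.
apply/obeysP/obeysP => H c.
  have := H (c - h); rewrite !ffunE /up /left /=.
  by rewrite [c - h - xstep]addrAC [c - h + tstep]addrAC !subrK.
have := H (c + h); rewrite !ffunE /up /left /=.
by rewrite [c + h - xstep]addrAC [c + h + tstep]addrAC.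
Qed.

Lemma inputs_shift h g : tinputs (shift h g) = tinputs g.
Proof.
apply/setP => d; apply/imsetP/imsetP => -[c _ ->].
  by exists (c + h); rewrite // !ffunE /left /= addrAC.
by exists (c - h); rewrite // !ffunE /left /= [c - h - xstep]addrAC !subrK.
Qed.

(** Two tiles form a single pattern on the disjoint union of two tori, so that the bounds for one
    pattern apply to pairs. *)
Definition glue_map (u : torus -> torus) (c : torus + torus) :=
  match c with inl a => inl (u a) | inr b => inr (u b) end : torus + torus.

Lemma glue_map_inj u : injective u -> injective (glue_map u).
Proof. by move=> uI [a|a] [b|b] //= [/uI ->]. Qed.

Definition glue (g g' : {ffun torus -> E}) : {ffun torus + torus -> E} :=
  [ffun c => match c with inl a => g a | inr b => g' b end].

Notation gobeys := (obeys (glue_map left) (glue_map id) (glue_map up)).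
Notation ginputs := (inputs (glue_map left) (glue_map id)).

Lemma obeys_glue g g' f : gobeys (glue g g') f = tobeys g f && tobeys g' f.
Proof.
apply/obeysP/andP => [H|[/obeysP H /obeysP H'] [a|b]]; last 2 first.
- by rewrite !ffunE /= H.
- by rewrite !ffunE /= H'.
by split; apply/obeysP => c; [have := H (inl c)|have := H (inr c)];
  rewrite !ffunE.
Qed.

Lemma states_glue g g' : states (glue g g') = states g :|: states g'.
Proof.
apply/setP => e; rewrite finset.in_setU; apply/imsetP/orP => [[[a|b] _ ->]|[]].
- by left; rewrite ffunE imset_f.
- by right; rewrite ffunE imset_f.
- by case/imsetP => c _ ->; exists (inl c); rewrite ?ffunE.
- by case/imsetP => c _ ->; exists (inr c); rewrite ?ffunE.
Qed.

(* If inputs and states were equally many, every state would have a unique pair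
   of parents; following parents back in time from a common state, the two tiles
   would agree on its whole backward light cone, hence up to translation. *)
Lemma ltn_states_glue g g' f c c' : tobeys g f -> tobeys g' f ->
  g c = g' c' -> g' \notin orb g ->
  (#|states (glue g g')| < #|ginputs (glue g g')|)%N.
Proof.
move=> gf g'f gc g'g; rewrite ltn_neqAle; apply/andP; split; last first.
  apply: (@leq_states_inputs _ _ _ (glue_map up) _ _ _ f); last first.
    by rewrite obeys_glue gf.
  exact/glue_map_inj/up_inj.
apply: contra g'g => /eqP si.
have /simpleP H :
    simple (glue_map left) (glue_map id) (glue_map up) (glue g g').
  by rewrite (@simple_obeys _ _ _ _ _ _ _ f) ?si ?obeys_glue ?gf//;
    exact/glue_map_inj/up_inj.
have step a b : g (a + tstep) = g' (b + tstep) ->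
    g (a - xstep) = g' (b - xstep) /\ g a = g' b.
  by move=> ab; have := H (inl a) (inr b); rewrite !ffunE /= /up ab eqxx;
    move/esym/eqP => [].
have back_t j a b : g a = g' b -> g (a - tstep *+ j) = g' (b - tstep *+ j).
  elim: j => [|j IHj] ab; first by rewrite !mulr0n !subr0.
  rewrite mulrSr !opprD !addrA.
  by case: (step (a - tstep *+ j - tstep) (b - tstep *+ j - tstep));
    rewrite ?subrK ?IHj.
have back_x i a b : g a = g' b ->
    g (a - (xstep + tstep) *+ i) = g' (b - (xstep + tstep) *+ i).
  elim: i => [|i IHi] ab; first by rewrite !mulr0n !subr0.
  rewrite mulrSr !opprD !addrA !(addrAC _ (- xstep) (- tstep)).
  by case: (step (a - (xstep + tstep) *+ i - tstep)
                 (b - (xstep + tstep) *+ i - tstep)); rewrite ?subrK ?IHi.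
have back h a b : g a = g' b -> g (a - h) = g' (b - h).
  have [i [j ->]] := torus_cone h => ab.
  by rewrite mulrnDr addrA -mulrnDl opprD !addrA; apply/back_t/back_x.
(* Going back by [c' - b] from the common state leads to [b] in [g'] and to [b + (c - c')] in
   [g]. *)
apply/imsetP; exists (c - c') => //; apply/ffunP => b; rewrite ffunE.
have /= := back (c' - b) _ _ gc; rewrite !opprB.
by rewrite [c' + _]addrCA subrr addr0 => <-; rewrite addrCA.
Qed.

End Tile.

(** Invariance under a translation only involves which cells carry equal states. *)
Lemma stab_kernel (E : finType) (g : {ffun torus -> E}) :
  stab (kernel g) = stab g.
Proof.
apply/setP => h; rewrite !inE; apply/eqP/eqP => /ffunP gh; apply/ffunP => c.
  by rewrite [LHS]ffunE; apply/eqP; rewrite -kernelE -(gh c) [eqbRHS]ffunE.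
by rewrite [LHS]ffunE; apply/eqP; rewrite kernelE -(gh c) ffunE.
Qed.

Lemma simple_kernel (E : finType) (g : {ffun torus -> E}) :
  simple left id up (kernel g) = simple left id up g.
Proof.
by apply/simpleP/simpleP => H c c'; have := H c c';
  rewrite !xpair_eqE !kernelE.
Qed.

End Torus.

(** * Size biasing the number of orbits *)

Section Count.
Variables (N S : nat) (E : finType) (P : pred {set torus N S}).
Hypothesis E_gt0 : (0 < #|E|)%N.
Variable R : realFieldType.

Notation tile := {ffun torus N S -> E}.
Notation frule := {ffun E * E -> E}.
Notation tobeys := (obeys (@left N S) id (@up N S)).
Notation tinputs := (inputs (@left N S) id).
Notation tsimple := (simple (@left N S) id (@up N S)).
Notation tow := (overwrite (@left N S) id (@up N S)).
Notation q := (#|E|%:R : R).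
Implicit Types (g : tile) (f : frule).

(** The restriction [P] is put on the stabilizer because that is unchanged by translations and by
    passing to the kernel. *)
Definition tiles f := [set g : tile | P (stab g) && tobeys g f].

Definition count f := #|[set orb g | g in tiles f]|.

(* The inverse of the orbit size, written so that it visibly depends on the
   kernel of [g] only. *)
Definition weight (T : finType) (g : {ffun torus N S -> T}) : R :=
  #|stab g|%:R / #|{: torus N S}|%:R.

Definition avg (h : frule -> R) : R := #|{: frule}|%:R^-1 * \sum_f h f.

Lemma card_frule_gt0 : 0 < #|{: frule}|%:R :> R.
Proof.
rewrite ltr0n; have [e _] := card_gt0P E_gt0.
by apply/card_gt0P; exists [ffun=> e].
Qed.

Lemma avg_ge0 h : (forall f, 0 <= h f) -> 0 <= avg h.
Proof. by move=> h0; rewrite mulr_ge0 ?invr_ge0 ?ler0n ?sumr_ge0. Qed.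

Lemma le_avg h h' : (forall f, h f <= h' f) -> avg h <= avg h'.
Proof. by move=> hh'; rewrite ler_pM2l ?invr_gt0 ?card_frule_gt0 ?ler_sum. Qed.

Lemma ler_norm_avg h : `|avg h| <= avg (fun f => `|h f|).
Proof.
by rewrite normrM ger0_norm ?invr_ge0 ?ler0n// ler_wpM2l ?invr_ge0 ?ler0n//
   ler_norm_sum.
Qed.

Lemma avgB h h' : avg h - avg h' = avg (fun f => h f - h' f).
Proof. by rewrite /avg -mulrBr -sumrB. Qed.

Lemma avgZ a h : a * avg h = avg (fun f => a * h f).
Proof. by rewrite /avg mulrCA mulr_sumr. Qed.

Lemma avg_sum (J : finType) (B : pred J) (h : J -> frule -> R) :
  avg (fun f => \sum_(j | B j) h j f) = \sum_(j | B j) avg (h j).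
Proof. by rewrite /avg exchange_big mulr_sumr. Qed.

Lemma avg1 : avg (fun=> 1) = 1.
Proof.
by rewrite /avg sumr_const mulVf// gt_eqF// card_frule_gt0.
Qed.

Lemma weight_ge0 (T : finType) (g : {ffun torus N S -> T}) : 0 <= weight g.
Proof. by rewrite divr_ge0 ?ler0n. Qed.

Lemma weight_le1 (T : finType) (g : {ffun torus N S -> T}) : weight g <= 1.
Proof.
rewrite ler_pdivrMr ?mul1r ?ler_nat ?max_card// ltr0n.
by apply/card_gt0P; exists 0.
Qed.

(** The members of an orbit share the same weight, the inverse of the orbit size, so each orbit
    contributes 1. *)
Lemma countE f : (count f)%:R = \sum_(g in tiles f) weight g.
Proof.
rewrite /count -sum1_card natr_sum (partition_big_imset (@orb N S E)) /=.
apply: eq_bigr => _ /imsetP[g gf ->].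
rewrite (eq_bigl (mem (orb g))); last first.
  move=> g'; rewrite /= orb_eq andb_idl// => /imsetP[h _ ->].
  by move: gf; rewrite !inE stab_shift obeys_shift.
rewrite (eq_bigr (fun=> weight g)); last first.
  by move=> _ /imsetP[h _ ->]; rewrite /weight stab_shift.
rewrite sumr_const -[weight g *+ _]mulr_natl mulrA -natrM card_orb_stab divff//.
by rewrite pnatr_eq0 -lt0n; apply/card_gt0P; exists 0.
Qed.

Definition realizable g := [exists f, tobeys g f].

Lemma avg_obeys g h : realizable g ->
  avg (fun f => (tobeys g f)%:R * h f) =
  q ^- #|tinputs g| * avg (h \o tow g).
Proof.
move=> /existsP[f0 gf0].
rewrite /avg (eq_bigr (fun f => if tobeys g f then h f else 0)); last first.
  by move=> f _; case: ifP; rewrite ?mul1r ?mul0r.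
by rewrite -big_mkcond (sum_overwrite _ gf0 E_gt0) mulrCA.
Qed.

Lemma avg_obeys0 g h : ~~ realizable g ->
  avg (fun f => (tobeys g f)%:R * h f) = 0.
Proof.
move=> gN; rewrite /avg big1 ?mulr0// => f _.
case: (boolP (tobeys g f)) => [gf|_]; last by rewrite mul0r.
by case/existsP: gN; exists f.
Qed.

(** The expected orbit count, by [avg_count]. *)
Definition intensity : R :=
  \sum_(g | P (stab g) && realizable g) weight g * q ^- #|tinputs g|.

(** [count] is a sum of weights of obeyed tiles; condition on each of these tiles in turn. *)
Lemma size_bias (h : frule -> R) :
  avg (fun f => (count f)%:R * h f) =
  \sum_(g | P (stab g) && realizable g)
    weight g * (q ^- #|tinputs g| *
      avg (h \o tow g)).
Proof.
transitivity (\sum_(g | P (stab g)) weight g *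
    avg (fun f => (tobeys g f)%:R * h f)).
  rewrite -(eq_bigr _ (fun g _ => esym (avgZ _ _))) -avg_sum /avg.
  congr (_ * _); apply: eq_bigr => f _; rewrite countE mulr_suml.
  rewrite big_mkcond [RHS]big_mkcond /=; apply: eq_bigr => g _.
  rewrite inE; case: (P _) => //=.
  by case: (tobeys g f); rewrite ?mul1r// mul0r mulr0.
rewrite (bigID realizable) /= addrC big1 ?add0r; last first.
  by move=> g /andP[_ gN]; rewrite avg_obeys0 ?mulr0.
by apply: eq_bigr => g /andP[_ gR]; rewrite avg_obeys.
Qed.

Lemma avg_count : avg (fun f => (count f)%:R) = intensity.
Proof.
have := size_bias (fun=> 1).
have -> : avg (fun f => (count f)%:R * 1) = avg (fun f => (count f)%:R).
  by congr (_ * _); apply: eq_bigr => f _; rewrite mulr1.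
move=> ->; apply: eq_bigr => g _.
by rewrite (_ : avg _ = 1) ?mulr1// avg1.
Qed.

Definition meet g g' := [exists c, exists c',
  (g (left c), g c) == (g' (left c'), g' c')].

Lemma meetP g g' d : d \in tinputs g -> d \in tinputs g' -> meet g g'.
Proof.
move=> /imsetP[c _ ->] /imsetP[c' _ cc'].
by apply/existsP; exists c; apply/existsP; exists c'; rewrite -cc'.
Qed.

Lemma obeys_overwrite_eq g g' f :
  ~~ meet g g' -> tobeys g' (tow g f) = tobeys g' f.
Proof.
move=> gg'.
have H c : tow g f (g' (left c), g' c) = f (g' (left c), g' c).
  apply: overwrite_out; apply: contra gg' => cg.
  by apply: (meetP cg); exact: imset_f.
by apply/obeysP/obeysP => gf c; have := gf c; rewrite /= H.
Qed.

(** Tiles that do not meet [g] ignore the overwriting. Those that meet [g] are absent before and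
    translates of [g] after, so exactly the orbit of [g] is gained. *)
Lemma count_overwrite g f : P (stab g) -> realizable g ->
  (forall g', g' \in tiles f -> ~~ meet g g') ->
  (forall g', g' \in tiles (tow g f) ->
     meet g g' -> g' \in orb g) ->
  count (tow g f) = (count f).+1.
Proof.
move=> gP /existsP[f0 gf0] old new; rewrite /count.
have -> : tiles (tow g f) = tiles f :|: orb g.
  apply/setP => g'; rewrite finset.in_setU; apply/idP/orP => [g't|[g't|]].
  - have [/(new _ g't)|gg'] := boolP (meet g g'); [by right|left].
    by move: g't; rewrite !inE obeys_overwrite_eq.
  - move: (g't); rewrite !inE => /andP[-> /=].
    by rewrite obeys_overwrite_eq ?old.
  - case/imsetP => h _ ->; rewrite inE stab_shift gP obeys_shift /=.
    exact: obeys_overwrite gf0.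
rewrite imsetU.
have -> : [set orb g' | g' in orb g] = [set orb g].
  apply/setP => O; rewrite inE; apply/imsetP/eqP => [[g' + ->]|->].
    by rewrite -orb_eq => /eqP.
  by exists g; rewrite ?orb_refl.
(* The orbit of [g] is not counted already: a translate of [g] has the same inputs, hence meets [g],
   contrary to [old]. *)
rewrite finset.setUC cardsU1; case: imsetP => // -[g' g't /eqP].
rewrite orb_eq => /imsetP[h _ gE]; have := old _ g't.
have g0 : (g (left 0), g 0) \in tinputs g by exact: imset_f.
by rewrite (meetP g0)// -(inputs_shift h) -gE.
Qed.

End Count.

(** * The approximate recursion for the law of the orbit count *)

Section Step.
Variables (N S : nat) (E : finType) (P : pred {set torus N S}).
Hypothesis E_gt0 : (0 < #|E|)%N.
Variable R : realFieldType.

Notation tile := {ffun torus N S -> E}.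
Notation frule := {ffun E * E -> E}.
Notation tobeys := (obeys (@left N S) id (@up N S)).
Notation tinputs := (inputs (@left N S) id).
Notation tsimple := (simple (@left N S) id (@up N S)).
Notation gobeys :=
  (obeys (glue_map (@left N S)) (glue_map id) (glue_map (@up N S))).
Notation ginputs := (inputs (glue_map (@left N S)) (glue_map id)).
Notation tow := (overwrite (@left N S) id (@up N S)).
Notation q := (#|E|%:R : R).
Notation avg := (@avg E R).
Notation tiles := (@tiles N S E P).
Notation count := (@count N S E P).
Notation C2 :=
  (#|{: {ffun torus N S + torus N S -> torus N S + torus N S}}|%:R : R).
Implicit Types (g : tile) (f : frule).

Lemma expVn_ge0 k : 0 <= q ^- k.
Proof. by rewrite invr_ge0 exprn_ge0. Qed.

Lemma ler_expVn a b : (a <= b)%N -> q ^- b <= q ^- a.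
Proof.
move=> ab; rewrite lef_pV2 ?posrE ?exprn_gt0 ?ltr0n//.
by rewrite ler_weXn2l// ler1n.
Qed.

Lemma avg_obeys_le (I : finType) (l m nx : I -> I) (g : {ffun I -> E}) :
  avg (fun f => (obeys l m nx g f)%:R) <= q ^- #|inputs l m g|.
Proof.
have [/existsP[f0 gf0]|gN] := boolP [exists f, obeys l m nx g f].
  rewrite /avg -natr_sum.
  have -> : (\sum_f obeys l m nx g f)%:R =
     \sum_(f | obeys l m nx g f) (1 : R).
    by rewrite natr_sum [RHS]big_mkcond; apply: eq_bigr => f _; case: ifP.
  rewrite (sum_overwrite _ gf0 E_gt0) mulrCA.
  by rewrite -[X in _ * X]/(avg (fun=> 1)) avg1// mulr1.
rewrite /avg big1 ?mulr0 ?expVn_ge0// => f _.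
by case: (boolP (obeys _ _ _ _ _)) => // gf; case/existsP: gN; exists f.
Qed.

(** Gluing is a bijection from pairs of tiles to patterns on the disjoint union. *)
Lemma sum_glue_le :
  \sum_g \sum_(g' : tile) q ^- #|states (glue g g')| <= C2.
Proof.
rewrite pair_big /= -(reindex (fun gg : tile * tile => glue gg.1 gg.2)
  (P := xpredT) (F := fun t => q ^- #|states t|)); first exact: sum_states_le.
apply: onW_bij.
exists (fun t : {ffun torus N S + torus N S -> E} =>
  ([ffun c => t (inl c)] : tile, [ffun c => t (inr c)] : tile)).
  by move=> [g g'] /=; congr pair; apply/ffunP => c; rewrite !ffunE.
by move=> t; apply/ffunP => -[c|c]; rewrite !ffunE.
Qed.

Lemma card_states_glue_meet g g' : meet g g' ->
  (#|states (glue g g')| < #|states g| + #|states g'|)%N.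
Proof.
move=> /existsP[c /existsP[c' /eqP[_ cc']]].
rewrite states_glue -cardsUI -addn1 leq_add2l card_gt0.
by apply/set0Pn; exists (g c); rewrite inE {2}cc' !imset_f.
Qed.

Lemma avg_tiles_le g g' :
  avg (fun f => (tobeys g f && (g' \in tiles f))%:R) <=
  q ^- #|ginputs (glue g g')|.
Proof.
apply: le_trans (avg_obeys_le _ _ (glue_map (@up N S)) _).
apply: le_avg => // f; rewrite obeys_glue inE ler_nat.
by case: (tobeys g f); case: (P _); case: (tobeys g' f).
Qed.

(** For a pair of tiles the product of the factors is at most [q] to minus the sum of their numbers
    of states. A shared input means a shared state, so at least one factor [1 / q] is gained over
    [q ^- #|states (glue g g')|]. *)
Lemma sum_old_le :
  \sum_(g | P (stab g) && realizable g) q ^- #|tinputs g| *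
     avg (fun f => \sum_(g' | meet g g') (g' \in tiles f)%:R) <= C2 / q.
Proof.
apply: (@le_trans _ _
  (\sum_g \sum_g' q ^- #|states (glue g g')| / q)); last first.
  under eq_bigr do rewrite -mulr_suml.
  rewrite -mulr_suml ler_pM2r ?invr_gt0 ?ltr0n//; exact: sum_glue_le.
rewrite big_mkcond; apply: ler_sum => g _.
case: ifPn => [/andP[_ /existsP[f0 gf0]]|_]; last first.
  by apply: sumr_ge0 => g' _; rewrite mulr_ge0 ?expVn_ge0 ?invr_ge0 ?ler0n.
rewrite avg_sum mulr_sumr big_mkcond; apply: ler_sum => g' _.
case: ifPn => [gg'|_]; last by rewrite mulr_ge0 ?expVn_ge0 ?invr_ge0 ?ler0n.
apply: (@le_trans _ _ (q ^- #|states g| * q ^- #|states g'|)).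
  apply: ler_pM; rewrite ?expVn_ge0 ?avg_ge0//.
    by apply: ler_expVn; apply: (leq_states_inputs (@up_inj N S)) gf0.
  have [/existsP[f1 gf1]|gN] := boolP (realizable g').
    apply: le_trans (ler_expVn (leq_states_inputs (@up_inj N S) gf1)).
    apply: le_trans (avg_obeys_le _ _ (@up N S) _).
    apply: le_avg => // f; rewrite inE ler_nat.
    by case: (P _); case: (tobeys _ _).
  rewrite /avg big1 ?mulr0 ?expVn_ge0// => f _.
  rewrite inE andbC; case: (boolP (tobeys _ _)) => // gf.
  by case/existsP: gN; exists f.
by rewrite -!invfM -exprD -exprSr ler_expVn// card_states_glue_meet.
Qed.

(** By [avg_obeys] each term is the probability that both tiles are obeyed. Such a pair has more
    inputs than states by [ltn_states_glue], whence the factor [1 / q]. *)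
Lemma sum_new_le :
  \sum_(g | P (stab g) && realizable g) q ^- #|tinputs g| *
     avg ((fun f => \sum_(g' | meet g g' && (g' \notin orb g))
       (g' \in tiles f)%:R) \o tow g) <= C2 / q.
Proof.
apply: (@le_trans _ _
  (\sum_g \sum_g' q ^- #|states (glue g g')| / q)); last first.
  under eq_bigr do rewrite -mulr_suml.
  rewrite -mulr_suml ler_pM2r ?invr_gt0 ?ltr0n//; exact: sum_glue_le.
rewrite big_mkcond; apply: ler_sum => g _.
case: ifPn => [/andP[_ gR]|_]; last first.
  by apply: sumr_ge0 => g' _; rewrite mulr_ge0 ?expVn_ge0 ?invr_ge0 ?ler0n.
rewrite -avg_obeys//.
have -> : avg (fun f => (tobeys g f)%:R *
    \sum_(g' | meet g g' && (g' \notin orb g)) (g' \in tiles f)%:R) =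
  avg (fun f => \sum_(g' | meet g g' && (g' \notin orb g))
     (tobeys g f && (g' \in tiles f))%:R).
  congr (_ * _); apply: eq_bigr => f _; rewrite mulr_sumr.
  by apply: eq_bigr => g' _; rewrite -natrM mulnb.
rewrite avg_sum big_mkcond; apply: ler_sum => g' _.
case: ifPn => [/andP[gg' g'g]|_]; last first.
  by rewrite mulr_ge0 ?expVn_ge0 ?invr_ge0 ?ler0n.
have [/existsP[f /andP[gf]]|gN] :=
  boolP [exists f, tobeys g f && (g' \in tiles f)].
  rewrite inE => /andP[_ g'f].
  apply: le_trans (avg_tiles_le _ _) _.
  rewrite -invfM -exprSr ler_expVn//.
  move: gg' => /existsP[c /existsP[c' /eqP[_ cc']]].
  exact: ltn_states_glue gf g'f cc' g'g.
rewrite /avg big1 ?mulr0 ?mulr_ge0 ?expVn_ge0 ?invr_ge0 ?ler0n// => f _.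
by case: (boolP (_ && _)) => // gf; case/existsP: gN; exists f.
Qed.

(* [count (overwrite g f) = count f + 1] fails only if some other tile sharing
   an input with [g] is obeyed before or after overwriting. *)
Lemma count_step k :
  `|k.+1%:R * avg (fun f => (count f == k.+1)%:R) -
    intensity E P R * avg (fun f => (count f == k)%:R)| <= 2 * C2 / q.
Proof.
(* Where [count f = k.+1] the factor [k.+1] is [count f] itself, so [size_bias] applies. *)
have -> : k.+1%:R * avg (fun f => (count f == k.+1)%:R) =
    avg (fun f => (count f)%:R * (count f == k.+1)%:R).
  rewrite avgZ; congr (_ * _); apply: eq_bigr => f _.
  by case: eqP => [->|]; rewrite ?mulr0.
rewrite size_bias// /intensity mulr_suml -sumrB.
apply: le_trans (ler_norm_sum _ _ _) _.
rewrite mulrDl mulrDl mul1r.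
apply: le_trans (lerD sum_old_le sum_new_le).
rewrite -big_split /=; apply: ler_sum => g /andP[gP gR].
rewrite -mulrA -mulrBr -mulrBr normrM ger0_norm ?weight_ge0//.
rewrite normrM ger0_norm ?expVn_ge0// mulrCA -mulrDr ler_wpM2l ?expVn_ge0//.
apply: (@le_trans _ _ (`|avg ((fun f => (count f == k.+1)%:R) \o tow g) -
    avg (fun f => (count f == k)%:R)|)).
  by apply: ler_piMl; rewrite ?weight_le1.
rewrite avgB; apply: le_trans (ler_norm_avg _) _.
rewrite /avg -mulrDr -big_split; apply: le_avg => // f /=.
(* [O] and [W] count the disturbing tiles before and after overwriting; the indicators differ by at
   most 1, and agree when both counts vanish. *)
set O := \sum_(_ | _) _; set W := \sum_(_ | _) _.
have O0 : 0 <= O by apply: sumr_ge0.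
have W0 : 0 <= W by apply: sumr_ge0.
have le1 : `|(count (tow g f) == k.+1)%:R - (count f == k)%:R| <= 1 :> R.
  by case: eqP; case: eqP => _ _;
    rewrite ?subrr ?subr0 ?sub0r ?normrN ?normr0 ?normr1.
have [/existsP[g' /andP[gg' g't]]|oldN] :=
  boolP [exists g', meet g g' && (g' \in tiles f)].
  apply: le_trans le1 _; rewrite ler_wpDr//.
  by rewrite /O (bigD1 g')//= g't lerDl sumr_ge0.
have [/existsP[g' /andP[gg' g't]]|newN] := boolP [exists g',
    (meet g g' && (g' \notin orb g)) && (g' \in tiles (tow g f))].
  apply: le_trans le1 _; rewrite ler_wpDl//.
  by rewrite /W (bigD1 g')//= g't lerDl sumr_ge0.
rewrite count_overwrite ?eqSS ?subrr ?normr0 ?addr_ge0//.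
  move=> g' g't; apply: contra oldN => gg'.
  by apply/existsP; exists g'; rewrite gg'.
move=> g' g't gg'; apply: contraR newN => g'g.
by apply/existsP; exists g'; rewrite gg' g'g.
Qed.

End Step.

(** * Convergence of the expected orbit count *)

Section Intensity.
Variables (N S : nat) (P : pred {set torus N S}) (R : realFieldType).
Notation T := (torus N S).
Notation tsimple := (simple (@left N S) id (@up N S)).
Notation tinputs := (inputs (@left N S) id).

(** A kernel is a tile up to renaming of states. For a simple kernel the expected number of obeyed
    tiles with that kernel tends to 1, so its weight survives in the limit. *)
Definition limit_intensity : R :=
  \sum_(k : {ffun T -> T} | (kernel k == k) && (P (stab k) && tsimple k))
     weight R k.

(** The ratio is the product of [1 - i / n] over [i < s]; the induction keeps it between
    [1 - s ^ 2 / n] and 1. *)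
Lemma ffact_ratio n s : (0 < n)%N ->
  `|(n ^_ s)%:R / n%:R ^+ s - 1| <= (s ^ 2)%:R / n%:R :> R.
Proof.
move=> n0; have q0 : 0 < n%:R :> R by rewrite ltr0n.
suff : 1 - (s ^ 2)%:R / n%:R <= ((n ^_ s)%:R / n%:R ^+ s : R) <= 1.
  move=> /andP[lo hi]; rewrite ler_norml; apply/andP; split; last first.
    by rewrite (le_trans (y := 0)) ?subr_le0// divr_ge0 ?ler0n.
  by rewrite lerBrDr addrC.
elim: s => [|s /andP[lo hi]].
  by rewrite ffactn0 expr0 mul0r subr0 divr1 lexx.
have [sn|ns] := leqP s n; last first.
  have -> : (n ^_ s.+1 = 0)%N by rewrite ffact_small// ltnW.
  rewrite mul0r ler01 andbT subr_le0 ler_pdivlMr// mul1r ler_nat.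
  by rewrite -mulnn; nia.
rewrite ffactnSr natrM exprSr invfM mulrACA natrB//.
have -> : (n%:R - s%:R) / n%:R = 1 - s%:R / n%:R :> R by field; rewrite gt_eqF.
set x := _%:R / _ ^+ _ in lo hi *.
have y0 : 0 <= (s%:R / n%:R : R) <= 1.
  by rewrite divr_ge0 ?ler0n//= ler_pdivrMr// mul1r ler_nat.
have x0 : 0 <= x by rewrite divr_ge0 ?ler0n// exprn_ge0.
have z0 : (s.+1 ^ 2)%:R / n%:R =
    (s ^ 2)%:R / n%:R + 2 * (s%:R / n%:R) + n%:R^-1 :> R.
  by rewrite -addn1 sqrnD muln1 exp1n !natrD natrM; field; rewrite gt_eqF.
have n1 : 0 < n%:R^-1 :> R by rewrite invr_gt0.
rewrite z0; set y := s%:R / n%:R in y0 *; case/andP: y0 => y0 y1.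
have xy : x * y <= y by exact: ler_piMl.
have xy0 : 0 <= x * y by exact: mulr_ge0.
by rewrite mulrBr mulr1; apply/andP; split; lra.
Qed.

(** [A] is the part of the intensity due to simple tiles. The other tiles have more inputs than
    states, which costs a factor [1 / #|E|] ([near1]); in [A], falling factorials are replaced by
    powers ([near2]). *)
Lemma intensity_dist (E : finType) : (0 < #|E|)%N ->
  `|intensity E P R - limit_intensity| <=
  (#|{: {ffun T -> T}}| * (1 + #|{: T}| ^ 2))%:R / #|E|%:R.
Proof.
move=> E0.
pose W (k : {ffun T -> T}) : R :=
  if P (stab k) && tsimple k then weight R k else 0.
pose A := \sum_(g : {ffun T -> E}) W (kernel g) * #|E|%:R ^- #|states g|.
have AE : A = \sum_(g : {ffun T -> E} | P (stab g) && tsimple g)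
    weight R g * #|E|%:R ^- #|tinputs g|.
  rewrite [RHS]big_mkcond; apply: eq_bigr => g _.
  rewrite /W stab_kernel simple_kernel /weight stab_kernel.
  case: ifPn => [/andP[_ gs]|]; last by rewrite mul0r.
  have [e0 _] := card_gt0P E0.
  have [f gf] := simple_obeysW e0 gs; move: gs.
  by rewrite (simple_obeys (@up_inj N S) gf) => /eqP ->.
have near1 : `|intensity E P R - A| <= #|{: {ffun T -> T}}|%:R / #|E|%:R.
  have -> : intensity E P R - A =
      \sum_(g : {ffun T -> E} | P (stab g) && realizable g && ~~ tsimple g)
        weight R g * #|E|%:R ^- #|tinputs g|.
    rewrite /intensity (bigID (fun g : {ffun T -> E} => tsimple g)) /=.
    rewrite addrC AE -addrA.
    rewrite [X in _ + (X - _)](_ : _ = A) ?AE ?subrr ?addr0//.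
    apply: eq_bigl => g; case: (P _) => //=.
    apply/andP/idP => [[]//|gs]; split=> //; apply/existsP.
    by have [e0 _] := card_gt0P E0; exact: simple_obeysW e0 gs.
  rewrite ger0_norm; last first.
    by apply: sumr_ge0 => g _; rewrite mulr_ge0 ?weight_ge0 ?expVn_ge0.
  rewrite (le_trans _ (ler_wpM2r _ (sum_states_le _ R E0))) ?invr_ge0//.
  rewrite mulr_suml big_mkcond; apply: ler_sum => g _.
  case: ifPn => [/andP[/andP[_ /existsP[f gf]] gs]|_]; last first.
    by rewrite mulr_ge0 ?expVn_ge0 ?invr_ge0 ?ler0n.
  rewrite (le_trans (ler_piMl _ (weight_le1 _ _))) ?expVn_ge0//.
  rewrite -invfM -exprSr ler_expVn// ltn_neqAle.
  rewrite (leq_states_inputs (@up_inj N S) gf) andbT.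
  by rewrite eq_sym -(simple_obeys (@up_inj N S) gf).
have near2 : `|A - limit_intensity| <=
    (#|{: {ffun T -> T}}| * #|{: T}| ^ 2)%:R / #|E|%:R.
  rewrite /A sum_kernel /limit_intensity big_mkcondr -sumrB.
  apply: le_trans (ler_norm_sum _ _ _) _.
  apply: (@le_trans _ _ (\sum_(k : {ffun T -> T}) (#|{: T}| ^ 2)%:R / #|E|%:R)).
    rewrite big_mkcond; apply: ler_sum => k _; case: ifP => _; last first.
      by rewrite divr_ge0 ?ler0n.
    rewrite -/(W k) -[X in _ - X]mulr1 -mulrBr normrM.
    have W1 : `|W k| <= 1.
      rewrite /W; case: ifP; rewrite ?normr0//.
      by rewrite ger0_norm ?weight_ge0 ?weight_le1.
    rewrite (le_trans (ler_piMl _ W1))//.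
    apply: le_trans (ffact_ratio _ E0) _.
    by rewrite ler_pM2r ?invr_gt0 ?ltr0n// ler_nat leq_exp2r// max_card.
  by rewrite sumr_const -[X in X <= _]mulr_natl mulrA -natrM.
rewrite mulnDr muln1 natrD mulrDl.
apply: le_trans (lerD near1 near2).
by rewrite (le_trans _ (ler_normD _ _))// addrA subrK.
Qed.

End Intensity.

(** * Tiles and periodic solutions *)

Section Dynamics.
Variables (n T S : nat).

(** The torus has [N.+1] times, so its time period is the factorial of [T], a common multiple of all
    temporal periods up to [T]. *)
Definition tperiod := T`!.-1.

Lemma tperiodE : tperiod.+1 = T`!.
Proof. by rewrite prednK// fact_gt0. Qed.

Notation N := tperiod.
Notation tstep := (tstep N S).
Notation xstep := (xstep N S).

(* [A] stands for the stabilizer of a tile under translations. *)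
Definition periods_ok (A : {set torus N S}) :=
  [exists tau : 'I_T.+1, (0 < tau)%N && (tstep *+ tau \in A)] &&
  [forall k : 'I_S.+1, (k != 0) ==> ((0, k) \notin A)].

Definition unfold (g : {ffun torus N S -> 'I_n}) : spacetime n :=
  fun t x => g (tstep *+ t + xstep *~ x).

Lemma xstep_period : xstep *+ S.+1 = 0.
Proof. by rewrite xstepMn; congr pair; apply: val_inj; rewrite /= modnn. Qed.

Lemma stab_unfold g k : tstep *+ k \in stab g -> forall t x,
  unfold g (t + k)%N x = unfold g t x.
Proof.
rewrite inE => /eqP/ffunP gk t x.
by have := gk (tstep *+ t + xstep *~ x); rewrite ffunE /unfold mulrnDr addrAC.
Qed.

Lemma generated_unfold g (f : rule n) :
  obeys (@left N S) id (@up N S) g f -> generated_by f (unfold g).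
Proof.
move=> /obeysP gf t x; rewrite /unfold.
have := gf (tstep *+ t + xstep *~ x); rewrite /left /up /=.
by rewrite mulrzBr mulr1z addrA => ->; rewrite mulrSr addrAC.
Qed.

Lemma generated_xshift (f : rule n) xi (k : int) : generated_by f xi ->
  (forall x, xi 0%N (x + k) = xi 0%N x) -> forall t x, xi t (x + k) = xi t x.
Proof.
move=> gen xi0; elim=> // t IHt x.
by rewrite !gen IHt -[x + k - 1]addrAC IHt.
Qed.

Lemma generated_tshift (f : rule n) xi k : generated_by f xi ->
  (forall x, xi k x = xi 0%N x) -> forall t x, xi (t + k)%N x = xi t x.
Proof.
move=> gen xi0; elim=> // t IHt x.
by rewrite addSn !gen !IHt.
Qed.

(** Since [tau] divides the time period of the torus, [xi] descends to the torus; [g] is its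
    restriction to a fundamental domain. *)
Lemma tile_of_PS (f : rule n) tau xi : (1 <= tau <= T)%N ->
  is_PS f tau S.+1 xi -> exists g, g \in tiles periods_ok f.
Proof.
move=> /andP[tau0 tauT] [gen [_ xS minS] [_ xt _]].
have tper := generated_tshift gen xt.
have xper := generated_xshift gen xS.
have xitN k t x : xi (t + k * N.+1)%N x = xi t x.
  have /dvdnP[m ->] : (tau %| N.+1)%N by rewrite tperiodE dvdn_fact ?tau0.
  rewrite mulnA; elim: (k * m)%N => [|j IHj]; first by rewrite mul0n addn0.
  by rewrite mulSn addnCA addnC tper.
have xixS (k : int) t x : xi t (x + k * S.+1%:Z) = xi t x.
  have pos j y : xi t (y + j%:Z * S.+1%:Z) = xi t y.
    elim: j => [|j IHj]; first by rewrite mul0r addr0.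
    by rewrite -addn1 PoszD mulrDl mul1r addrA xper.
  case: (intP k) => [|j|j]; rewrite ?pos ?mul0r ?addr0//.
  by rewrite -[LHS](pos j.+1) mulNr subrK.
pose g : {ffun torus N S -> 'I_n} :=
  [ffun c : torus N S => xi c.1 (c.2 : nat)%:Z].
have gE t x : unfold g t x = xi t x.
  rewrite /unfold ffunE.
  have [q [r xE]] : exists q : int, exists r : nat, x = r%:Z + q * S.+1%:Z.
    exists (x %/ S.+1%:Z)%Z, `|(x %% S.+1%:Z)%Z|%N.
    by rewrite gez0_abs ?modz_ge0// addrC -divz_eq.
  have -> : xstep *~ x = xstep *+ r.
    by rewrite xE mulrzDr mulrC mulrzA -[xstep *~ S.+1%:Z]/(xstep *+ S.+1)
      xstep_period mul0rz addr0.
  have -> : tstep *+ t + xstep *+ r = (inZp t, inZp r).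
    by rewrite tstepMn xstepMn; congr pair; rewrite /= ?addr0 ?add0r.
  rewrite /=.
  rewrite -(xitN (t %/ N.+1)%N) addnC -divn_eq xE xixS.
  rewrite [in RHS](divn_eq r S.+1) PoszD PoszM addrC.
  by rewrite xixS.
have gE' (c : torus N S) : g c = xi c.1 (c.2 : nat)%:Z.
  by rewrite ffunE.
exists g; rewrite inE; apply/andP; split; last first.
  apply/obeysP => c.
  have -> : up c = tstep *+ c.1.+1 + xstep *~ (c.2 : nat)%:Z.
    by rewrite {1}(torusE c) /up mulrSr addrAC.
  have -> : left c = tstep *+ c.1 + xstep *~ ((c.2 : nat)%:Z - 1).
    by rewrite {1}(torusE c) /left mulrzBr mulr1z addrA.
  by have := gen c.1 (c.2 : nat)%:Z; rewrite -!gE /unfold => ->;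
    rewrite -torusE.
apply/andP; split.
  apply/existsP; exists (Ordinal (n := T.+1) (m := tau) tauT).
  rewrite tau0 /= inE.
  apply/eqP/ffunP => c; rewrite ffunE (torusE c) addrAC -mulrnDr.
  by rewrite -[LHS]/(unfold g _ (c.2 : nat)%:Z) gE tper -gE.
apply/forallP => k; apply/implyP => k0.
have {}k0 : (0 < k)%N.
  by rewrite lt0n; apply: contra k0 => /eqP k0; apply/eqP/val_inj.
rewrite inE; apply/eqP => /ffunP gk.
(* A stabilizing shift [(0, k)] would be a spatial period below the minimal one, [S.+1]. *)
suff /(minS _ k0) : forall x, xi 0%N (x + k%:Z) = xi 0%N x.
  by rewrite leqNgt ltn_ord.
move=> x; rewrite -!gE /unfold mulrzDr addrA.
have -> : xstep *~ k%:Z = (0, k) :> torus N S.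
  by rewrite -[LHS]/(xstep *+ k) xstepMn valZpK.
by have := gk (tstep *+ 0 + xstep *~ x); rewrite ffunE.
Qed.

(** The stabilizer yields some temporal period at most [T]; the smallest one is then extracted. *)
Lemma PS_of_tile (f : rule n) g : g \in tiles periods_ok f ->
  exists2 tau, (1 <= tau <= T)%N & exists xi, is_PS f tau S.+1 xi.
Proof.
rewrite inE.
move=> /andP[/andP[/existsP[tau0 /andP[tau0_gt0 tau0g]] /forallP xg] gf].
have gen := generated_unfold gf; set xi := unfold g in gen *.
pose Q t := `[< (0 < t)%N /\ forall x, xi t x = xi 0%N x >].
have Qtau0 : Q tau0.
  apply/asboolP; split => // x.
  by have := stab_unfold tau0g 0%N x; rewrite add0n.
have exQ : exists t, Q t by exists tau0.
case: (ex_minnP exQ) => tau /asboolP[tau_gt0 tauE] tau_min.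
exists tau; first by rewrite tau_gt0 (leq_trans (tau_min _ Qtau0))// -ltnS.
exists xi; split => //; last first.
  by split => // k k0 kE; apply: tau_min; apply/asboolP.
split=> // [x|k k0 kE].
  rewrite /xi /unfold mulrzDr -[xstep *~ S.+1%:Z]/(xstep *+ S.+1).
  by rewrite xstep_period addr0.
(* A smaller period of the initial row persists at all times, so it would stabilize the whole
   tile. *)
rewrite leqNgt; apply/negP => kS.
have /implyP/(_ _)/negP := xg (Ordinal kS); apply.
  by rewrite -(inj_eq val_inj) /= -lt0n.
rewrite inE; apply/eqP/ffunP => c; rewrite ffunE.
have -> : (0, Ordinal kS) = xstep *~ k%:Z.
  rewrite -[RHS]/(xstep *+ k) xstepMn; congr pair; apply: val_inj.
  by rewrite /= modn_small.
rewrite (torusE c) -addrA -[xstep *+ c.2]/(xstep *~ (c.2 : nat)%:Z) -mulrzDr.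
exact: generated_xshift gen kE _ _.
Qed.

End Dynamics.

(** * [Y] in terms of the orbit count *)

Section Law.
Variable R : realType.

(** If no period is at most [T], the infimum is at least [T.+1], including the case [+oo] of an
    empty set. *)
Lemma Y_leP (n T S : nat) (f : rule n) :
  reflect (exists2 tau, (1 <= tau <= T)%N & exists xi, is_PS f tau S.+1 xi)
    (Y S.+1 n f <= (T%:R : R)%:E)%E.
Proof.
apply: (iffP idP) => [|[tau /andP[tau0 tauT] [xi PSxi]]]; last first.
  apply: (@le_trans _ _ (tau%:R : R)%:E); last by rewrite lee_fin ler_nat.
  apply: ereal_inf_lbound; exists tau => //; split=> //.
  by exists (translation_class xi), xi.
apply: contraPP => noPS; apply/negP; rewrite -ltNge.
apply: (@lt_le_trans _ _ (T.+1%:R : R)%:E); first by rewrite lte_fin ltr_nat.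
apply: le_ereal_inf_tmp => _ [tau [tau0 [_ [xi PSxi _]]] <-].
rewrite lee_fin ler_nat ltnNge; apply/negP => tauT; apply: noPS.
by exists tau; [rewrite tau0|exists xi].
Qed.

Lemma Y_eqP (n k S : nat) (f : rule n) :
  Y S.+1 n f = (k.+1%:R : R)%:E <->
  (Y S.+1 n f <= (k.+1%:R : R)%:E)%E /\ ~ (Y S.+1 n f <= (k%:R : R)%:E)%E.
Proof.
split=> [->|[Yk1 Yk]].
  by rewrite lexx lee_fin ler_nat ltnn.
apply/eqP; rewrite eq_le Yk1 /=.
apply: le_ereal_inf_tmp => _ [tau [tau0 [_ [xi PSxi _]]] <-].
rewrite lee_fin ler_nat ltnNge; apply/negP => tauk; apply: Yk.
by apply/Y_leP; exists tau; [rewrite tau0|exists xi].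
Qed.

Lemma Y_le_count (n T S : nat) (f : rule n) :
  (Y S.+1 n f <= (T%:R : R)%:E)%E = (count (@periods_ok T S) f != 0%N).
Proof.
rewrite -lt0n.
apply/Y_leP/card_gt0P => [[tau tauT [xi PSxi]] | [B /imsetP[g gf _]]].
  have [g gf] := tile_of_PS tauT PSxi.
  by exists (orb g); exact: imset_f.
exact: PS_of_tile gf.
Qed.

End Law.

(** * The Poisson limit *)

Section PoissonLimit.
Variable R : realType.
Local Open Scope classical_set_scope.

Lemma cvg_sumr (J : Type) (s : seq J) (u : J -> nat -> R) (l : J -> R) :
  (forall j, u j n @[n --> \oo] --> l j) ->
  \sum_(j <- s) u j n @[n --> \oo] --> \sum_(j <- s) l j.
Proof.
move=> ul; elim: s => [|j s IHs].
  rewrite big_nil (_ : (fun _ => _) = fun=> 0); first exact: cvg_cst.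
  by apply/funext => n; rewrite big_nil.
rewrite big_cons (_ : (fun _ => _) = fun n => u j n + \sum_(j <- s) u j n).
  exact: cvgD.
by apply/funext => n; rewrite big_cons.
Qed.

(** [a n k] stands for the probability of the count [k]. The recursion makes it close to
    [exp_coeff (lam n) k * a n 0]; summing over [k < K], with the tail under control by Markov's
    inequality, gives [expR L * a n 0 --> 1]. *)
Lemma poisson_zero_limit (a : nat -> nat -> R) (lam : nat -> R) (L : R) :
  (forall n k, 0 <= a n k) ->
  (forall n K, \sum_(k < K) a n k <= 1) ->
  (forall n K, 1 - \sum_(k < K.+1) a n k <= lam n / K.+1%:R) ->
  lam n @[n --> \oo] --> L ->
  (forall k, k.+1%:R * a n k.+1 - lam n * a n k @[n --> \oo] --> (0 : R)) ->
  a n 0%N @[n --> \oo] --> expR (- L).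
Proof.
move=> a0 asum amarkov lamL astep.
have apprx k : a n k - exp_coeff (lam n) k * a n 0%N @[n --> \oo] --> (0 : R).
  elim: k => [|k IHk].
    rewrite (_ : (fun _ => _) = fun=> 0); first exact: cvg_cst.
    by apply/funext => n; rewrite /exp_coeff /= expr0 fact0 divr1 mul1r subrr.
  rewrite (_ : (fun _ => _) = fun n =>
    k.+1%:R^-1 * (k.+1%:R * a n k.+1 - lam n * a n k) +
    k.+1%:R^-1 * lam n * (a n k - exp_coeff (lam n) k * a n 0%N)).
    rewrite -[X in _ --> X](_ : k.+1%:R^-1 * 0 + k.+1%:R^-1 * L * 0 = 0);
      last by rewrite !mulr0 addr0.
    apply: cvgD; first by apply: cvgM => //; exact: cvg_cst.
    by apply: cvgM => //; apply: cvgM => //; exact: cvg_cst.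
  apply/funext => n; rewrite /exp_coeff /= exprS factS natrM invfM.
  field; rewrite pnatr_eq0 -lt0n fact_gt0 /=.
  by rewrite -[1]/(1%:R) -natrD pnatr_eq0.
have apprxS K : \sum_(k < K) a n k - series (exp_coeff (lam n)) K * a n 0%N
    @[n --> \oo] --> (0 : R).
  rewrite (_ : (fun _ => _) = fun n =>
    \sum_(k < K) (a n k - exp_coeff (lam n) k * a n 0%N)).
    rewrite -[X in _ --> X](_ : \sum_(k < K) (0 : R) = 0); last by rewrite big1.
    by apply: cvg_sumr => k; exact: apprx.
  by apply/funext => n; rewrite sumrB -mulr_suml /series /= big_mkord.
have lamS K : series (exp_coeff (lam n)) K @[n --> \oo] -->
    series (exp_coeff L) K.
  rewrite /series /= (_ : (fun _ => _) = fun n =>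
    \sum_(0 <= k < K) exp_coeff (lam n) k) //.
  apply: cvg_sumr => k; rewrite /exp_coeff /=.
  apply: cvgM; last exact: cvg_cst.
  elim: (k) => [|j IHj].
    by rewrite (_ : (fun _ => _) = fun=> 1); [exact: cvg_cst|apply/funext].
  rewrite (_ : (fun _ => _) = fun n => lam n * lam n ^+ j); last first.
    by apply/funext => n; rewrite exprS.
  by rewrite exprS; exact: cvgM.
suff main : expR L * a n 0%N @[n --> \oo] --> (1 : R).
  rewrite (_ : (fun _ => _) = fun n => expR (- L) * (expR L * a n 0%N)).
    rewrite -[X in _ --> X]mulr1.
    by apply: cvgM => //; exact: cvg_cst.
  by apply/funext => n; rewrite mulrA -expRD addNr expR0 mul1r.
apply/cvgrPdist_le => e e0.
have e4 : 0 < e / 4 by lra.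
(* [L + 1] serves as an eventual bound on [lam n] in the Markov tail. *)
have : \forall K \near \oo, `|expR L - series (exp_coeff L) K| <= e / 4 /\
    (L + 1) / K%:R <= e / 4.
  near=> K; split.
    near: K; have /cvgrPdist_le := is_cvg_series_exp_coeff L.
    by move=> /(_ _ e4).
  have K0 : 0 < K%:R :> R by rewrite ltr0n; near: K; exists 1%N.
  rewrite ler_pdivrMr// mulrC -ler_pdivrMr//.
  by near: K; exact: nbhs_infty_ger.
case=> K0 _ /(_ K0.+1 (leqnSn _)) [K1 K2].
set K := K0.+1 in K1 K2.
near=> n.
have a01 : 0 <= a n 0%N <= 1.
  by rewrite a0 (le_trans _ (asum n 1%N))// big_ord1.
have h1 :
    `|\sum_(k < K) a n k - series (exp_coeff (lam n)) K * a n 0%N| <= e / 4.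
  near: n; have /cvgr0Pnorm_le := apprxS K; exact.
have h2 : `|series (exp_coeff L) K - series (exp_coeff (lam n)) K| <= e / 4.
  near: n; have /cvgrPdist_le := lamS K; exact.
have h3 : 1 - \sum_(k < K) a n k <= e / 4.
  apply: le_trans (amarkov n K0) _; apply: le_trans _ K2.
  rewrite ler_pM2r ?invr_gt0 ?ltr0n//.
  near: n; apply: (cvgr_le L) => //; lra.
have h4 := asum n K.
(* Four errors of at most [e / 4]: the tail, the recursion, the truncation of the exponential
   series, and [lam n] in place of [L]. *)
have -> : 1 - expR L * a n 0%N = (1 - \sum_(k < K) a n k) +
   (\sum_(k < K) a n k - series (exp_coeff (lam n)) K * a n 0%N) -
   (expR L - series (exp_coeff L) K) * a n 0%N -
   (series (exp_coeff L) K - series (exp_coeff (lam n)) K) * a n 0%N by ring.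
have small (x : R) : `|x| <= e / 4 -> `|x * a n 0%N| <= e / 4.
  move=> xe; rewrite normrM; apply: le_trans xe.
  by case/andP: a01 => a00 a01; rewrite ler_piMr// ger0_norm.
move: (small _ K1) (small _ h2) h1.
rewrite !ler_norml => /andP[? ?] /andP[? ?] /andP[? ?].
by apply/andP; split; lra.
Unshelve. all: by end_near. Qed.

End PoissonLimit.

(** * The limiting probability that the orbit count is zero *)

Section CountLimit.
Variables (N S : nat) (P : pred {set torus N S}) (R : realType).
Local Open Scope classical_set_scope.

Lemma cvg0_harmonic_bound (u : nat -> R) (C : R) :
  (forall n, `|u n| <= C / n.+1%:R) -> u n @[n --> \oo] --> (0 : R).
Proof.
move=> uC; apply: norm_cvg0.
apply: (@squeeze_cvgr _ _ _ _ (fun=> 0) (fun n => C * @harmonic R n)).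
- by apply: nearW => n; rewrite normr_ge0 uC.
- exact: cvg_cst.
- rewrite -[X in _ --> X](mulr0 C).
  by apply: cvgM; [exact: cvg_cst|exact: cvg_harmonic].
Qed.

Lemma sum_count_eq (E : finType) K (f : {ffun E * E -> E}) :
  \sum_(k < K) ((count P f == k)%:R : R) = (count P f < K)%:R.
Proof.
elim: K => [|K IHK]; first by rewrite big_ord0 ltn0.
rewrite big_ord_recr /= IHK -natrD ltnS [in RHS]leq_eqVlt.
by case: (ltngtP (count P f) K).
Qed.

Lemma count0_limit :
  avg (fun f : {ffun 'I_n.+1 * 'I_n.+1 -> 'I_n.+1} => (count P f == 0)%:R)
    @[n --> \oo] --> expR (- limit_intensity P R).
Proof.
have E0 n : (0 < #|'I_n.+1|)%N by rewrite card_ord.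
pose a n k := avg (fun f : {ffun 'I_n.+1 * 'I_n.+1 -> 'I_n.+1} =>
  (count P f == k)%:R) : R.
have aS n K : \sum_(k < K) a n k =
    avg (fun f : {ffun 'I_n.+1 * 'I_n.+1 -> 'I_n.+1} => (count P f < K)%:R).
  rewrite -avg_sum; congr (_ * _); apply: eq_bigr => f _.
  exact: sum_count_eq.
apply: (@poisson_zero_limit _ a (fun n => intensity 'I_n.+1 P R)).
- by move=> n k; apply: avg_ge0 => f; rewrite ler0n.
- move=> n K; rewrite aS -[leRHS](avg1 (E0 n) R).
  by apply: le_avg => // f; rewrite lern1 leq_b1.
(* Markov's inequality: the indicator of [K < count] is at most [count / K.+1]. *)
- move=> n K; rewrite aS -[X in X - _](avg1 (E0 n) R) avgB.
  rewrite -(avg_count _ (E0 n)).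
  rewrite mulrC avgZ; apply: le_avg => // f.
  case: ltnP => fK; first by rewrite subrr mulr_ge0 ?invr_ge0 ?ler0n.
  by rewrite subr0 mulrC ler_pdivlMr ?ltr0n// mul1r ler_nat.
- apply/subr_cvg0.
  apply: (@cvg0_harmonic_bound _
    (#|{: {ffun torus N S -> torus N S}}| *
       (1 + #|{: torus N S}| ^ 2))%:R) => n.
  by apply: le_trans (intensity_dist _ _ (E0 n)) _; rewrite card_ord.
- move=> k; apply: (@cvg0_harmonic_bound _ (2 *
    #|{: {ffun torus N S + torus N S -> torus N S + torus N S}}|%:R)) => n.
  by apply: le_trans (count_step _ (E0 n) _ _) _; rewrite card_ord.
Qed.

End CountLimit.

(** * Divergence of the limit intensity *)

Section LowerBound.
Variables (T S : nat) (R : realType).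
Notation N := (tperiod T).

(* Its orbit contributes at least 1 / (tau sigma) to the limit intensity. *)
Definition mod_tile tau : {ffun torus N S -> torus N S} :=
  [ffun c : torus N S => (inZp (c.1 %% tau), c.2)].

Lemma mod_tileE tau (c c' : torus N S) : (0 < tau <= T)%N ->
  (mod_tile tau c == mod_tile tau c') =
  (c.1 == c'.1 %[mod tau])%N && (c.2 == c'.2).
Proof.
move=> /andP[tau0 tauT]; rewrite !ffunE xpair_eqE; congr andb.
have tauN : (tau <= N.+1)%N.
  by rewrite tperiodE dvdn_leq ?fact_gt0// dvdn_fact ?tau0.
have small (a : nat) : (a %% tau < N.+1)%N.
  by rewrite (leq_trans _ tauN)// ltn_pmod.
by rewrite -(inj_eq val_inj) /= !(modn_small (small _)).
Qed.

Lemma dvd_tperiod tau : (0 < tau <= T)%N -> (tau %| N.+1)%N.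
Proof. by move=> tauT; rewrite tperiodE dvdn_fact. Qed.

(** A state records time modulo [tau] and position, so a child and its pair of parents determine
    each other. *)
Lemma mod_tile_simple tau : (0 < tau <= T)%N ->
  simple (@left N S) id (@up N S) (mod_tile tau).
Proof.
move=> tauT; apply/simpleP => c c'.
rewrite xpair_eqE !mod_tileE//.
have up2 (d : torus N S) : (up d).2 = d.2 by exact: addr0.
have left1 (d : torus N S) : (left d).1 = d.1 by exact: subr0.
have upE (d : 'I_N.+1) : ((d + inZp 1)%R : 'I_N.+1) = d.+1 %[mod tau].
  by rewrite /= modnDmr modn_dvdm ?dvd_tperiod// addn1.
rewrite !up2 !left1 !upE -[c.1.+1]addn1 -[c'.1.+1]addn1 eqn_modDr.
have -> : ((left c).2 == (left c').2) = (c.2 == c'.2).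
  by rewrite /left /= (inj_eq (addIr _)).
by case: (c.1 == _ %[mod tau])%N; rewrite /= ?andbb.
Qed.

Lemma mod_tile_stab tau : (0 < tau <= T)%N ->
  tstep N S *+ tau \in stab (mod_tile tau).
Proof.
move=> tauT; rewrite inE; apply/eqP/ffunP => c; rewrite ffunE.
apply/eqP; rewrite mod_tileE// tstepMn /= addr0 eqxx andbT.
by rewrite modnDmr modn_dvdm ?dvd_tperiod// modnDr.
Qed.

Lemma mod_tile_periods tau : (0 < tau <= T)%N ->
  @periods_ok T S (stab (mod_tile tau)).
Proof.
move=> tauT; apply/andP; split.
  have tT : (tau < T.+1)%N by case/andP: tauT.
  apply/existsP; exists (Ordinal tT) => /=.
  by rewrite mod_tile_stab// andbT; case/andP: tauT.
apply/forallP => k; apply/implyP; apply: contra.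
rewrite inE => /eqP/ffunP/(_ 0).
by rewrite ffunE => /eqP; rewrite mod_tileE// => /andP[_]; rewrite /= add0r.
Qed.

(** A shift by [tau] time steps fixes the tile, so its orbit has at most [tau * S.+1] members. *)
Lemma mod_tile_weight tau : (0 < tau <= T)%N ->
  (tau * S.+1)%:R^-1 <= weight R (mod_tile tau).
Proof.
move=> tauT; have tau0 : (0 < tau)%N by case/andP: tauT.
set g := mod_tile tau.
have orb_le : (#|orb g| <= tau * S.+1)%N.
  have shiftM j h : shift (tstep N S *+ (tau * j) + h) g = shift h g.
    elim: j => [|j IHj]; first by rewrite muln0 mulr0n add0r.
    rewrite mulnS mulrnDr -addrA addrC -shiftD.
    by have := mod_tile_stab tauT; rewrite inE => /eqP ->.
  apply: (@leq_trans #|[set shift (tstep N S *+ p.1 + xstep N S *+ p.2) g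
     | p : 'I_tau * 'I_S.+1]|); last first.
    by apply: (leq_trans (leq_imset_card _ _)); rewrite card_prod !card_ord.
  apply: subset_leq_card; apply/fintype.subsetP => _ /imsetP[h _ ->].
  apply/imsetP; exists (Ordinal (ltn_pmod h.1 tau0), h.2) => //=.
  rewrite {1}(torusE h) {1}(divn_eq h.1 tau) mulrnDr mulnC -addrA.
  exact: shiftM.
have := card_orb_stab g => GE.
rewrite /weight -GE [X in _ <= _ / X]natrM invfM mulrCA mulfV ?mulr1;
  last first.
  by rewrite pnatr_eq0 -lt0n card_stab_gt0.
rewrite lef_pV2 ?ler_nat// posrE ltr0n ?muln_gt0 ?tau0//.
by apply/card_gt0P; exists g; exact: orb_refl.
Qed.

(** For [tau < tau'] the cells at times 0 and [tau] agree in the first tile and differ in the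
    second. *)
Lemma mod_tile_inj tau tau' : (0 < tau <= T)%N -> (0 < tau' <= T)%N ->
  kernel (mod_tile tau) = kernel (mod_tile tau') -> tau = tau'.
Proof.
wlog lt_tau : tau tau' / (tau < tau')%N => [wl tauT tauT' ker|].
  by have [/wl|/wl H|//] := ltngtP tau tau'; [exact|rewrite H].
move=> tauT tauT' /eq_kernelP H; exfalso.
have tauN : (tau < N.+1)%N.
  by rewrite (leq_trans lt_tau)// dvdn_leq// dvd_tperiod.
have := H (Ordinal tauN, 0) 0; rewrite !mod_tileE//= !eqxx !andbT !mod0n.
rewrite modnn eqxx modn_small// => /esym/eqP tau0.
by move: tauT; rewrite tau0.
Qed.

(** The tiles [mod_tile] have distinct kernels, and the other terms of the limit intensity are
    nonnegative. *)
Lemma limit_intensity_ge :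
  \sum_(tau < T) (tau.+1 * S.+1)%:R^-1 <= limit_intensity (@periods_ok T S) R.
Proof.
pose k (tau : 'I_T) := kernel (mod_tile tau.+1).
have tauT (tau : 'I_T) : (0 < tau.+1 <= T)%N by rewrite ltn_ord.
have k_inj : injective k.
  by move=> t t' /(mod_tile_inj (tauT t) (tauT t')) [tt']; apply: val_inj.
rewrite /limit_intensity (bigID (mem [set k tau | tau : 'I_T])) /=.
apply: (@le_trans _ _ (\sum_(i in [set k tau | tau : 'I_T]) weight R i)).
  rewrite big_imset /=; last by move=> ? ? _ _; exact: k_inj.
  apply: ler_sum => tau _; rewrite /weight stab_kernel.
  exact: mod_tile_weight.
rewrite [X in X + _](_ : _ = \sum_(i in [set k tau | tau : 'I_T]) weight R i).
  by rewrite lerDl sumr_ge0// => i _; exact: weight_ge0.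
apply: eq_bigl => i; rewrite andb_idl// => /imsetP[tau _ ->].
rewrite /k kernel_id eqxx stab_kernel simple_kernel.
by rewrite mod_tile_periods// mod_tile_simple.
Qed.

End LowerBound.

(** * Weak convergence *)

Section NaturalLaw.
Local Open Scope classical_set_scope.
Variables (R : realType) (q : nat -> R).
Hypothesis q_ge0 : forall k, 0 <= q k.
Hypothesis q_sum1 : series q @ \oo --> (1 : R).

(** The index is shifted: [q k] is the mass at [k.+1]. *)
Definition nat_law : set (\bar R) -> \bar R :=
  mseries (fun k => mscale (NngNum (q_ge0 k)) (dirac (k.+1%:R%:E : \bar R))) 0.

HB.instance Definition _ := Measure.on nat_law.

Lemma nat_lawE A : nat_law A =
  (\sum_(0 <= k <oo) (q k * (k.+1%:R%:E \in A)%:R)%:E)%E.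
Proof.
by apply: eq_eseriesr => k _; rewrite EFinM -diracE.
Qed.

Lemma nat_law_setT : nat_law setT = 1%E.
Proof.
rewrite nat_lawE -[RHS]/((1 : R)%:E).
apply: cvg_lim => //; rewrite (_ : (fun _ => _) = EFin \o series q).
  by apply: cvg_EFin; [exact: nearW|exact: q_sum1].
apply/funext => n; rewrite sumEFin /series /=.
by congr EFin; apply: eq_bigr => k _; rewrite in_setT mulr1.
Qed.

HB.instance Definition _ :=
  Measure_isProbability.Build _ _ _ nat_law nat_law_setT.

Definition nat_prob : probability (\bar R) R := nat_law.

Lemma nat_prob_positive : nat_prob (positive_naturals (R := R)) = 1%E.
Proof.
rewrite -nat_law_setT [LHS]nat_lawE nat_lawE; apply: eq_eseriesr => k _.
by rewrite in_setT mem_set//; exists k.+1.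
Qed.

Lemma nat_prob_set1 k : nat_prob [set k.+1%:R%:E] = (q k)%:E.
Proof.
rewrite [LHS]nat_lawE (nneseriesD1 (n := k))//; last first.
  by move=> j _; rewrite lee_fin mulr_ge0.
rewrite mem_set// mulr1 eseries0 ?adde0// => j _ /andP[_ jk].
rewrite memNset ?mulr0// => -[] /eqP; rewrite eqr_nat eqSS => /eqP jk'.
by rewrite jk' eqxx in jk.
Qed.

(** A unit atom elsewhere, together with the positive mass at 1, would exceed total mass 1. *)
Lemma nat_prob_nondegenerate : 0 < q 0%N < 1 ->
  ~ exists x, nat_prob [set x] = 1%E.
Proof.
move=> /andP[q00 q01] [x x1].
have [xE|x_neq] := eqVneq x (1%:R%:E : \bar R).
  move: x1; rewrite xE nat_prob_set1 => -[] qE.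
  by rewrite qE ltxx in q01.
have := @probability_le1 _ _ _ nat_prob ([set x] `|` [set 1%:R%:E])
  (measurableU _ _ (emeasurable_set1 _) (emeasurable_set1 _)).
rewrite measureU//=; last first.
  by apply/seteqP; split => // y [/= -> /eqP]; rewrite (negbTE x_neq).
rewrite -[X in (X + _)%E]/(nat_prob [set x]) x1.
rewrite -[X in (_ + X)%E]/(nat_prob [set 1%:R%:E]) nat_prob_set1.
by rewrite -EFinD lee_fin; lra.
Qed.

End NaturalLaw.

(** * Integrals truncated to finitely many atoms *)

Section WeakConvergence.
Local Open Scope classical_set_scope.
Variable R : realType.
Implicit Types (mu : probability (\bar R) R) (g : \bar R -> R).

(** On the finite part [g] is [fine] followed by a continuous real function; two points remain. *)
Lemma continuous_ereal_measurable g : continuous g -> measurable_fun setT g.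
Proof.
move=> cg.
have cgE : continuous (g \o EFin).
  move=> r; apply: continuous_comp; last exact: cg.
  by apply: cvg_EFin; [exact: nearW|exact: cvg_id].
have -> : setT = [set x : \bar R | x \is a fin_num] `|`
    ([set +oo%E] `|` [set -oo%E]).
  apply/seteqP; split => // -[r| |] _ /=;
    [by left|by right; left|by right; right].
have mfin : measurable [set x : \bar R | x \is a fin_num].
  by rewrite -[X in measurable X]setTI; exact: emeasurable_fin_num.
apply/measurable_funU => //; first exact: measurableU.
split; last by apply/measurable_funU => //; split; exact: measurable_fun_set1.
apply: (eq_measurable_fun (g \o EFin \o fine)).
  by move=> x; rewrite inE => xfin /=; rewrite fineK.
apply: measurable_funTS; apply: measurableT_comp.
  exact: continuous_measurable_fun.
exact: fine_measurable.
Qed.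

Let tail (K : nat) := [set x : \bar R | forall k, (k < K)%N -> x <> k.+1%:R%:E].

Let tailS K : tail K = tail K.+1 `|` [set K.+1%:R%:E].
Proof.
apply/seteqP; split=> [x tx|x [tx k kK|-> k kK [] /eqP]].
- have [->|/eqP xK] := eqVneq x K.+1%:R%:E; first by right.
  by left => k; rewrite ltnS leq_eqVlt => /predU1P[->//|/tx].
- by apply: tx; rewrite ltnS ltnW.
- by rewrite eqr_nat eqSS gtn_eqF.
Qed.

Let tail_disj K : tail K.+1 `&` [set K.+1%:R%:E] = set0.
Proof. by apply/seteqP; split => // x [/= tx xK]; exact: (tx K). Qed.

Let measurable_tail K : measurable (tail K).
Proof.
elim: K => [|K IHK].
  by rewrite (_ : tail 0 = setT)//; apply/seteqP; split.
rewrite (_ : tail K.+1 = tail K `\` [set K.+1%:R%:E]); first exact: measurableD.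
rewrite [in RHS](tailS K) setDUl setDv setU0.
apply/seteqP; split => [x tx|x []//].
by split => // xK; exact: (tx K).
Qed.

Lemma measure_tail mu K :
  fine (mu (tail K)) = 1 - \sum_(k < K) fine (mu [set k.+1%:R%:E]).
Proof.
elim: K => [|K IHK].
  rewrite big_ord0 subr0 (_ : tail 0 = setT) ?probability_setT//.
  by apply/seteqP; split.
rewrite big_ord_recr /= opprD addrA -IHK (tailS K) measureU//.
by rewrite fineD ?fin_num_measure// addrK.
Qed.

Lemma bounded_integrable mu g M (D : set (\bar R)) : measurable D ->
  measurable_fun setT g -> (forall x, `|g x| <= M) ->
  mu.-integrable D (EFin \o g).
Proof.
move=> mD mg gM; apply: measurable_bounded_integrable => //.
- by rewrite (le_lt_trans (probability_le1 _ mD))// ltry.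
- exact: measurable_funTS.
- exists M; split; first exact: num_real.
  by move=> y My x _ /=; rewrite (le_trans (gM x))// ltW.
Qed.

(** The first [K] atoms are integrated exactly; on [tail K], which contains [+oo], the integrand is
    bounded by [M]. *)
Lemma Rintegral_atoms mu g M K : measurable_fun setT g ->
  (forall x, `|g x| <= M) ->
  `|(\int[mu]_x g x)%R - \sum_(k < K) g k.+1%:R%:E * fine (mu [set k.+1%:R%:E])|
  <= M * (1 - \sum_(k < K) fine (mu [set k.+1%:R%:E])).
Proof.
move=> mg gM.
have gi D : measurable D -> mu.-integrable D (EFin \o g).
  by move=> mD; exact: bounded_integrable gM.
have -> : (\int[mu]_x g x)%R -
    \sum_(k < K) g k.+1%:R%:E * fine (mu [set k.+1%:R%:E]) =
    (\int[mu]_(x in tail K) g x)%R.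
  elim: K => [|K IHK].
    rewrite big_ord0 subr0 (_ : tail 0 = setT)//.
    by apply/seteqP; split.
  rewrite big_ord_recr /= opprD addrA IHK (tailS K) Rintegral_setU//;
    last 2 first.
  - by apply: gi; rewrite -tailS; exact: measurable_tail.
  - by apply/disj_setPS; rewrite tail_disj.
  rewrite (_ : (\int[mu]_(x in [set K.+1%:R%:E]) g x)%R =
    g K.+1%:R%:E * fine (mu [set K.+1%:R%:E])) ?addrK//.
  rewrite -Rintegral_cst//; apply: eq_Rintegral => x.
  by rewrite inE => ->.
rewrite -measure_tail -Rintegral_cst//.
apply: le_trans (le_normr_Rintegral _ (gi _ _)) _ => //.
apply: le_Rintegral => //.
  have := gi _ (measurable_tail K) => /integrable_norm; exact.
apply: (@bounded_integrable _ _ `|M|) => //.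
Qed.

End WeakConvergence.

(** * The law of [Y] and its limit *)

Section LawOfY.
Local Open Scope classical_set_scope.
Variables (R : realType) (S : nat).
Notation EN k := ((k%:R : R)%:E).

Lemma uniform_ruleE n (b : pred (rule n)) :
  uniform_rule n [set f | b f] =
  (avg (fun f : {ffun 'I_n * 'I_n -> 'I_n} => (b f)%:R : R))%:E.
Proof.
rewrite /uniform_rule /mscale /= /counting asboolT; last exact: finite_finset.
have -> : fset_set [set f | b f] = [fset f in enum b]%fset.
  apply/fsetP => f; rewrite in_fset_set; last exact: finite_finset.
  rewrite !inE mem_enum; apply/idP/idP => [/set_mem//|bf].
  exact/mem_set.
rewrite card_fseq undup_id ?enum_uniq// -cardE -EFinM /avg.
congr (_ * _)%:E; rewrite -sum1_card natr_sum big_mkcond /=.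
by apply: eq_bigr => f _; rewrite unfold_in; case: (b f).
Qed.

(** The limiting probability that [Y] exceeds [T], by [survival_limit] and [Y_le_count]. *)
Definition survival T : R := expR (- limit_intensity (@periods_ok T S) R).

(** The two counts live on different tori; that the second event lies in the first follows through
    [Y_le_count]. *)
Lemma law_Y n k :
  distribution (@uniform_rule R n) (Y S.+1 n) [set EN k.+1] =
  (avg (fun f : {ffun 'I_n * 'I_n -> 'I_n} =>
     (count (@periods_ok k S) f == 0%N)%:R) -
   avg (fun f : {ffun 'I_n * 'I_n -> 'I_n} =>
     (count (@periods_ok k.+1 S) f == 0%N)%:R))%:E.
Proof.
pose b (f : rule n) := (count (@periods_ok k S) f == 0%N) &&
  (count (@periods_ok k.+1 S) f != 0%N).
rewrite [LHS](_ : _ = uniform_rule n [set f | b f]).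
  rewrite uniform_ruleE avgB; congr (avg _)%:E; apply/funext => f.
  rewrite /b.
  have : count (@periods_ok k.+1 S) f == 0%N ->
      count (@periods_ok k S) f == 0%N.
    apply: contraTT; rewrite -!(Y_le_count R) => /le_trans; apply.
    by rewrite lee_fin ler_nat.
  by do 2 case: (_ == 0%N) => //=; rewrite ?subrr ?subr0// => /(_ isT).
congr (uniform_rule n _); apply/seteqP; split=> f /=.
  move=> /Y_eqP[]; rewrite !(Y_le_count R) /b => -> /negP.
  by rewrite negbK => ->.
move=> /andP[f0 f1]; apply/Y_eqP; rewrite !(Y_le_count R); split => //.
exact/negP/negPn.
Qed.

Lemma survival_limit T :
  avg (fun f : {ffun 'I_n.+1 * 'I_n.+1 -> 'I_n.+1} =>
    (count (@periods_ok T S) f == 0)%:R) @[n --> \oo] --> survival T.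
Proof. exact: count0_limit. Qed.

Lemma law_Y_limit k :
  fine (distribution (@uniform_rule R n.+1) (Y S.+1 n.+1) [set EN k.+1])
    @[n --> \oo] --> survival k - survival k.+1.
Proof.
under eq_fun do rewrite law_Y.
by apply: cvgB; exact: survival_limit.
Qed.

Lemma survival0 : survival 0 = 1.
Proof.
rewrite /survival /limit_intensity big1 ?oppr0 ?expR0// => k.
move=> /andP[_ /andP[/andP[/existsP[[tau tau1] /andP[/= tau0 _]] _] _]].
by case: tau tau1 tau0.
Qed.

Definition limit_law k := survival k - survival k.+1.

(** A limit of probabilities is nonnegative; no comparison of the two limit intensities is made. *)
Lemma limit_law_ge0 k : 0 <= limit_law k.
Proof.
rewrite /limit_law -(cvg_lim _ (@law_Y_limit k))//.
apply: limr_ge; first by apply/cvg_ex; eexists; exact: law_Y_limit.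
by apply: nearW => n; rewrite fine_ge0.
Qed.

Lemma sum_limit_law K : \sum_(k < K) limit_law k = 1 - survival K.
Proof.
elim: K => [|K IHK]; first by rewrite big_ord0 survival0 subrr.
by rewrite big_ord_recr IHK /limit_law /=; lra.
Qed.

(** The limit intensity is at least the harmonic sum divided by [S.+1], and [1 + x <= expR x] gives
    [expR (- x) <= 1 / x] for [x > 0]. *)
Lemma survival_cvg0 : survival T @[T --> \oo] --> (0 : R).
Proof.
have H : series (@harmonic R) n @[n --> \oo] --> +oo.
  apply: nondecreasing_dvgn_lt; last exact: dvg_harmonic.
  by apply: nondecreasing_series => n _ _; exact: harmonic_ge0.
apply/cvgr0Pnorm_le => e e0; near=> T.
rewrite ger0_norm ?expR_ge0// /survival expRN.
have Tge : S.+1%:R * e^-1 <= series (@harmonic R) T.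
  by near: T; move/cvgryPge : H; exact.
have Lge : e^-1 <= limit_intensity (@periods_ok T S) R.
  apply: le_trans (limit_intensity_ge T S R).
  rewrite (eq_bigr (fun t : 'I_T => S.+1%:R^-1 * @harmonic R t)); last first.
    by move=> t _; rewrite natrM invfM mulrC.
  rewrite -mulr_sumr -(big_mkord xpredT (@harmonic R)).
  by rewrite mulrC ler_pdivlMr ?ltr0n// mulrC.
rewrite -[leRHS]invrK lef_pV2 ?posrE ?expR_gt0 ?invr_gt0//.
apply: le_trans (expR_ge1Dx _); lra.
Unshelve. all: by end_near. Qed.

Lemma limit_law_sum1 : series limit_law @ \oo --> (1 : R).
Proof.
rewrite (_ : series limit_law = fun K => 1 - survival K); last first.
  by apply/funext => K; rewrite -sum_limit_law /series /= big_mkord.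
rewrite -[X in _ --> X]subr0; apply: cvgB; first exact: cvg_cst.
exact: survival_cvg0.
Qed.

(** Temporal period 1 alone contributes at least [1 / S.+1] to the limit intensity, so
    [survival 1 < 1]. *)
Lemma limit_law0 : 0 < limit_law 0 < 1.
Proof.
rewrite /limit_law survival0 subr_gt0 ltrBlDr ltrDl expR_gt0 andbT.
rewrite /survival expR_lt1 oppr_lt0.
apply: lt_le_trans (limit_intensity_ge 1 S R).
by rewrite big_ord1 invr_gt0 ltr0n.
Qed.

Lemma integral_Rintegral (mu : probability (\bar R) R) (g : \bar R -> R)
    (M : R) :
  measurable_fun setT g -> (forall x, `|g x| <= M) ->
  (\int[mu]_x (g x)%:E = (\int[mu]_x g x)%R%:E)%E.
Proof.
move=> mg gM; rewrite fineK//.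
by apply: integrable_fin_num => //; exact: bounded_integrable gM.
Qed.

(** Both integrals are compared with sums over the first [K] atoms. These carry nearly all of [Q],
    hence eventually nearly all of [P n]: convergence of the atoms already gives tightness. *)
Lemma weak_limit (P : nat -> probability (\bar R) R)
    (Q : probability (\bar R) R) :
  (forall k, fine (P n [set EN k.+1]) @[n --> \oo] -->
     fine (Q [set EN k.+1])) ->
  (\sum_(k < K) fine (Q [set EN k.+1])) @[K --> \oo] --> (1 : R) ->
  weakly_converges P Q.
Proof.
move=> PQ Q1 g cg [M gM].
have mg := continuous_ereal_measurable cg.
have M0 : 0 <= M by apply: le_trans (gM 0%E).
under eq_fun do rewrite (integral_Rintegral _ mg gM).
rewrite (integral_Rintegral _ mg gM).
apply: cvg_EFin; first exact: nearW.
apply/cvgrPdist_le => e e0 /=.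
have [K MK] : exists K, M * (1 - \sum_(k < K) fine (Q [set EN k.+1])) <= e / 4.
  have : M * (1 - \sum_(k < K) fine (Q [set EN k.+1])) @[K --> \oo] --> (0 : R).
    rewrite -[X in _ --> X](mulr0 M) -[X in M * X](subrr 1).
    by apply: cvgM; [exact: cvg_cst|apply: cvgB => //; exact: cvg_cst].
  move/cvgr0Pnorm_le => /(_ (e / 4)) []; first by lra.
  move=> K _ /(_ K (leqnn K)) /= /(le_trans (ler_norm _)) ?; by exists K.
pose G n := \sum_(k < K) g (EN k.+1) * fine (P n [set EN k.+1]).
pose G0 := \sum_(k < K) g (EN k.+1) * fine (Q [set EN k.+1]).
pose W n := M * (1 - \sum_(k < K) fine (P n [set EN k.+1])).
have GG0 : G n @[n --> \oo] --> G0.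
  apply: cvg_sumr => k; apply: cvgM; first exact: cvg_cst.
  exact: PQ.
have WW : W n @[n --> \oo] --> M * (1 - \sum_(k < K) fine (Q [set EN k.+1])).
  apply: cvgM; first exact: cvg_cst.
  by apply: cvgB; [exact: cvg_cst|apply: cvg_sumr => k; exact: PQ].
near=> n.
have h1 : `|G0 - G n| <= e / 4.
  by near: n; move/cvgrPdist_le : GG0; apply; lra.
(* The limit of [W] is at most [e / 4]; the three errors [e / 4], [e / 4] and [e / 2] add up to
   [e]. *)
have h2 : W n <= e / 2 by near: n; apply: (cvgr_le _ WW); lra.
have := Rintegral_atoms (P n) K mg gM.
have := Rintegral_atoms Q K mg gM.
rewrite -/(G n) -/G0 -/(W n).
move: h1; rewrite !ler_norml => /andP[? ?] /andP[? ?] /andP[? ?].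
by apply/andP; split; lra.
Unshelve. all: by end_near. Qed.

End LawOfY.

Local Open Scope classical_set_scope.

Theorem corollary3 (R : realType) (sigma : nat) (hsigma : (1 <= sigma)%N) :
  exists Q : probability (\bar R) R,
    [/\ Q positive_naturals = 1%E,
        ~ (exists x : \bar R, Q [set x] = 1%E) &
        weakly_converges
          (fun n => distribution (uniform_rule n) (Y sigma n)) Q].
Proof.
case: sigma hsigma => // S _.
pose Q := nat_prob (@limit_law_ge0 R S) (@limit_law_sum1 R S).
exists Q; split.
- exact: nat_prob_positive.
- exact/nat_prob_nondegenerate/limit_law0.
- apply: weak_limit => [k|].
    (* [law_Y_limit] concerns [n.+1] states, hence the shift of the index. *)
    rewrite -(cvg_shiftS (fun n =>
      fine (distribution (@uniform_rule R n) (Y S.+1 n) _))).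
    rewrite nat_prob_set1; exact: law_Y_limit.
  under eq_fun do under eq_bigr do rewrite nat_prob_set1.
  have := @limit_law_sum1 R S; rewrite /series /=.
  by under eq_fun do rewrite big_mkord.
Qed.
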